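(* Suppose $\mu_n\subset K$, let $z\in V_n(K)$ and let $\gamma$ be a pro-$\ell$ path on $V_n\otimes\overline K$ from $\overrightarrow{01}$ to $z$. For $s\in\{0,\dots,n-1\}$ let $[n]:\frac sn+\mathbb Z_\ell\to\mathbb Z_\ell$, $a\mapsto na$, and for a measure $\kappa$ on $\frac sn+\mathbb Z_\ell$ let $[n]_*\kappa$ be the measure $U\mapsto\kappa([n]^{-1}(U))$ on compact open $U\subset\mathbb Z_\ell$. Then for every $\sigma\in G_K$, $$\boldsymbol\kappa_{z^n,\pi_n(\gamma)}(\sigma)=\sum_{\zeta\in\mu_n}[n]_*\,\boldsymbol\kappa_{\zeta z,\varepsilon_\zeta\jmath_\zeta(\gamma)}(\sigma),$$ where for $\zeta=\zeta_n^s$ the measure $\boldsymbol\kappa_{\zeta z,\varepsilon_\zeta\jmath_\zeta(\gamma)}(\sigma)$ lives on $\frac sn+\mathbb Z_\ell$.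
   Context: $K\subset\mathbb C$, $\overline K\subset\mathbb C$, $G_K=\mathrm{Gal}(\overline K/K)$, $\ell$ a prime, $\chi$ the $\ell$-adic cyclotomic character, $\zeta_N=e^{2\pi i/N}$. $V_n=\mathbf P^1\setminus(\{0,\infty\}\cup\mu_n)$, $V_1=\mathbf P^1\setminus\{0,1,\infty\}$, tangential base points $\overrightarrow{01}$, $\zeta\overrightarrow{01}$. Pro-$\ell$ étale paths composed left to right with $G_K$-action. $x$: standard loop on $V_1$ at $\overrightarrow{01}$ around $0$; $x^\alpha=\exp(\alpha\log x)$ in the $\ell$-adic pro-unipotent fundamental group, and $\mathbb Q_\ell$-paths are composites $x^\alpha\cdot\gamma$ etc. $\pi_n(z)=z^n$, $\jmath_\zeta(z)=\zeta z$. For $\zeta=\zeta_n^s$ ($0\le s<n$), $\delta_\zeta$ is the anticlockwise arc of angle $2\pi s/n$ from $\overrightarrow{01}$ to $\zeta\overrightarrow{01}$ and $\varepsilon_\zeta=x^{-s/n}\delta_\zeta$, so $\varepsilon_\zeta\jmath_\zeta(\gamma)=x^{-s/n}\cdot(\delta_\zeta\jmath_\zeta(\gamma))$ with $\delta_\zeta\jmath_\zeta(\gamma)$ a pro-$\ell$ path $\overrightarrow{01}\rightsquigarrow\zeta z$. For a $K$-point $w$ of $V_1$ and a pro-$\ell$ path $\gamma':\overrightarrow{01}\rightsquigarrow w$, let $\tilde\chi_k^{w,\gamma'}:G_K\to\mathbb Z_\ell$ be the $\ell$-adic polylogarithmic characters: $\gamma'$ determines compatible roots $w^{1/\ell^m}$,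 $(1-\zeta_{\ell^m}^\alpha w^{1/\ell^m})^{1/\ell^m}$ (continuation from the standard branches at $\overrightarrow{01}$), $\sigma(w^{1/\ell^m})=\zeta_{\ell^m}^{\rho_w(\sigma)}w^{1/\ell^m}$, and $\zeta_{\ell^m}^{\tilde\chi_k^{w}(\sigma)}=\sigma\bigl(\prod_{a=0}^{\ell^m-1}(1-\zeta_{\ell^m}^{\chi(\sigma)^{-1}a}w^{1/\ell^m})^{a^{k-1}/\ell^m}\bigr)/\prod_{a=0}^{\ell^m-1}(1-\zeta_{\ell^m}^{a+\rho_w(\sigma)}w^{1/\ell^m})^{a^{k-1}/\ell^m}$ for all $m$. The Kummer–Heisenberg measure $\boldsymbol\kappa_{w,\gamma'}(\sigma)$ is the $\mathbb Z_\ell$-valued measure on $\mathbb Z_\ell$ with $\int_{\mathbb Z_\ell}a^{k-1}\,d\boldsymbol\kappa_{w,\gamma'}(\sigma)(a)=\tilde\chi_k^{w,\gamma'}(\sigma)$ for all $k\ge1$. For a $\mathbb Q_\ell$-path $p=x^{-s/n}\gamma'$ (with $\mu_n\subset K$, $s\in\mathbb Z_\ell$), $\boldsymbol\kappa_{w,p}(\sigma)$ is the $\mathbb Z_\ell$-valued measure on $\frac sn+\mathbb Z_\ell$ characterized by $\int_{\frac sn+\mathbb Z_\ell}a^{k-1}d\boldsymbol\kappa_{w,p}(\sigma)(a)=\sum_{i=0}^{k-1}\binom{k-1}{i}\bigl(\tfrac sn\chi(\sigma)\bigr)^{k-1-i}\tilde\chi_{i+1}^{w,\gamma'}(\sigma)$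 for all $k\ge1$ (i.e. the translate of $\boldsymbol\kappa_{w,\gamma'}(\sigma)$ by $\frac sn\chi(\sigma)$; these moments equal the extended characters $\tilde{\boldsymbol\chi}_k^{w,p}(\sigma)$). *)

(* Defs.v *)
From HB Require Import structures.
From mathcomp Require Import all_boot all_order all_algebra.
From mathcomp Require Import all_classical reals topology trigo.
From mathcomp Require Import complex zify ring.

Set Implicit Arguments.
Unset Strict Implicit.
Unset Printing Implicit Defensive.
Import Order.TTheory GRing.Theory Num.Theory.
Local Open Scope classical_set_scope.
Local Open Scope ring_scope.

(* Z_l = lim Z/l^m; [res x m] is the representative of x mod l^m in [0, l^m). *)
Record padicint (l : nat) (hl : prime l) := Padicint {
  res :> nat -> nat;
  res_compat : forall m, res m = (res m.+1 %% l ^ m)%N }.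

Section PadicInt.
Variables (l : nat) (hl : prime l).
Local Notation Zl := (padicint hl).

HB.instance Definition _ := gen_eqMixin Zl.
HB.instance Definition _ := gen_choiceMixin Zl.

Lemma padicP (x y : Zl) : (forall m, res x m = res y m) -> x = y.
Proof.
case: x y => [x hx] [y hy] /= /funext xy; rewrite {x}xy in hx *.
by congr Padicint; exact: Prop_irrelevance.
Qed.

Lemma expl_gt0 m : (0 < l ^ m)%N.
Proof. by rewrite expn_gt0 prime_gt0. Qed.

Lemma res_lt (x : Zl) m : (res x m < l ^ m)%N.
Proof. by rewrite res_compat ltn_mod expl_gt0. Qed.

Lemma res_small (x : Zl) m : (res x m %% l ^ m)%N = res x m.
Proof. by rewrite modn_small ?res_lt. Qed.

Lemma res_le (x : Zl) m k : (m <= k)%N -> (res x k %% l ^ m)%N = res x m.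
Proof.
move=> /subnKC <-; elim: (k - m)%N => [|j IH]; first by rewrite addn0 res_small.
rewrite -{}IH (res_compat x (m + j)) addnS modn_dvdm //.
by rewrite dvdn_exp2l ?leq_addr.
Qed.

Definition mkpadic (f : nat -> nat)
    (hf : forall m, f m = f m.+1 %[mod l ^ m]) : Zl.
Proof.
exists (fun m => (f m %% l ^ m)%N) => m.
by rewrite modn_dvdm ?hf // dvdn_exp2l.
Defined.

Lemma modS (x : Zl) m : res x m = res x m.+1 %[mod l ^ m].
Proof. by rewrite [in LHS]res_compat modn_mod. Qed.

Lemma padic_nat_subproof n m : n = n %[mod l ^ m]. Proof. by []. Qed.

Lemma padic_add_subproof (x y : Zl) m :
  (res x m + res y m = res x m.+1 + res y m.+1 %[mod l ^ m])%N.
Proof. by rewrite -modnDm !modS modnDm. Qed.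

Lemma padic_mul_subproof (x y : Zl) m :
  (res x m * res y m = res x m.+1 * res y m.+1 %[mod l ^ m])%N.
Proof. by rewrite -modnMm !modS modnMm. Qed.

Lemma padic_opp_subproof (x : Zl) m :
  (res x m * (l ^ m).-1 = res x m.+1 * (l ^ m.+1).-1 %[mod l ^ m])%N.
Proof.
rewrite -modnMml modS modnMml.
have [] := (expl_gt0 m, expl_gt0 m.+1); rewrite expnS => h1 h2.
have -> : ((l * l ^ m).-1 = l.-1 * l ^ m + (l ^ m).-1)%N.
  have := prime_gt0 hl; case: l => // k _ /=; nia.
by rewrite mulnDr mulnA modnMDl.
Qed.

Definition padic_nat n := mkpadic (padic_nat_subproof n).
Definition padic_add x y := mkpadic (padic_add_subproof x y).
Definition padic_mul x y := mkpadic (padic_mul_subproof x y).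
Definition padic_opp x := mkpadic (padic_opp_subproof x).

Lemma padic_addA : associative padic_add.
Proof. by move=> x y z; apply: padicP => m /=; rewrite modnDml modnDmr addnA. Qed.
Lemma padic_addC : commutative padic_add.
Proof. by move=> x y; apply: padicP => m /=; rewrite addnC. Qed.
Lemma padic_add0 : left_id (padic_nat 0) padic_add.
Proof. by move=> x; apply: padicP => m /=; rewrite mod0n add0n res_small. Qed.
Lemma padic_addN : left_inverse (padic_nat 0) padic_opp padic_add.
Proof.
move=> x; apply: padicP => m /=; rewrite modnDml addnC -mulnS prednK ?expl_gt0 //.
by rewrite modnMl mod0n.
Qed.

HB.instance Definition _ := GRing.isZmodule.Build Zl
  padic_addA padic_addC padic_add0 padic_addN.

Lemma padic_mulA : associative padic_mul.
Proof. by move=> x y z; apply: padicP => m /=; rewrite modnMml modnMmr mulnA. Qed.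
Lemma padic_mulC : commutative padic_mul.
Proof. by move=> x y; apply: padicP => m /=; rewrite mulnC. Qed.
Lemma padic_mul1 : left_id (padic_nat 1) padic_mul.
Proof. by move=> x; apply: padicP => m /=; rewrite modnMml mul1n res_small. Qed.
Lemma padic_mulD : left_distributive padic_mul padic_add.
Proof. by move=> x y z; apply: padicP => m /=; rewrite modnMml modnDm mulnDl. Qed.
Lemma padic_1neq0 : padic_nat 1 != 0.
Proof.
apply/eqP => /(congr1 (fun x => res x 1%N)) /=; rewrite expn1.
by rewrite mod0n modn_small ?prime_gt1.
Qed.

HB.instance Definition _ := GRing.Zmodule_isComNzRing.Build Zl
  padic_mulA padic_mulC padic_mul1 padic_mulD padic_1neq0.

Definition padic_unit : {pred Zl} := [pred x : Zl | `[< exists y : Zl, y * x = 1 >]].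
Definition padic_inv (x : Zl) : Zl := xget x [set y : Zl | y * x = 1].

Lemma padic_mulVx : {in padic_unit, left_inverse 1 padic_inv *%R}.
Proof. by move=> x /asboolP hx; exact: (xgetPex x hx). Qed.
Lemma padic_unitP x y : y * x = 1 -> padic_unit x.
Proof. by move=> h; apply/asboolP; exists y. Qed.
Lemma padic_invr_out : {in [predC padic_unit], padic_inv =1 id}.
Proof.
move=> x /negP hx; rewrite /padic_inv; case: xgetP => // y _ hy.
by case: hx; exact: padic_unitP hy.
Qed.

HB.instance Definition _ := GRing.ComNzRing_hasMulInverse.Build Zl
  padic_mulVx padic_unitP padic_invr_out.

Lemma padic_idom (x y : Zl) : x * y = 0 -> (x == 0) || (y == 0).
Proof.
move=> xy0; apply: contraT; rewrite negb_or => /andP[/eqP x0 /eqP y0].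
have ne (z : Zl) : z <> 0 -> exists m, (0 < res z m)%N.
  move=> z0; apply: contrapT => h; apply: z0; apply: padicP => m /=.
  by rewrite mod0n; case: (posnP (res z m)) => // ?; case: h; exists m.
have [[i hi] [j hj]] := (ne x x0, ne y y0).
have nz (z : Zl) k : (0 < res z k)%N -> (0 < res z (i + j))%N ->
    (k <= i + j)%N -> (logn l (res z (i + j)) < k)%N.
  move=> hk hz kle; rewrite ltnNge -pfactor_dvdn //; apply/negP.
  by rewrite /dvdn res_le // => /eqP h; rewrite h in hk.
have pos (z : Zl) k : (0 < res z k)%N -> (k <= i + j)%N -> (0 < res z (i + j))%N.
  move=> hk kle; rewrite lt0n; apply/eqP => h.
  by move: hk; rewrite -(res_le z kle) h mod0n.
have xi := pos x i hi (leq_addr _ _).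
have yj := pos y j hj (leq_addl _ _).
have hx := nz x i hi xi (leq_addr _ _).
have hy := nz y j hj yj (leq_addl _ _).
have /(congr1 (fun z => res z (i + j))) /= := xy0.
rewrite mod0n => /eqP; rewrite -/(dvdn _ _) pfactor_dvdn ?muln_gt0 ?xi //.
rewrite lognM //; lia.
Qed.

HB.instance Definition _ := GRing.ComUnitRing_isIntegral.Build Zl padic_idom.
End PadicInt.

(* Q_l *)
Definition padic (l : nat) (hl : prime l) := {fraction (padicint hl)}.

Section Padic.
Variables (l : nat) (hl : prime l).
Local Notation Zl := (padicint hl).
Local Notation Ql := (padic hl).
HB.instance Definition _ := GRing.Field.on Ql.

Definition ofZl (u : Zl) : Ql := tofrac u.
HB.instance Definition _ := GRing.RMorphism.copy ofZl (@tofrac Zl).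

(* x + l^m Z_l *)
Definition padic_ball (x : Ql) (m : nat) : set Ql :=
  [set x + l%:R ^+ m * ofZl u | u in [set: Zl]].
Definition padic_nbhs (x : Ql) : set_system Ql :=
  [set A | exists m, padic_ball x m `<=` A].

HB.instance Definition _ := hasNbhs.Build Ql padic_nbhs.

Lemma padic_ballS (x : Ql) m k : (m <= k)%N -> padic_ball x k `<=` padic_ball x m.
Proof.
move=> /subnKC <- _ [u _ <-]; exists (l%:R ^+ (k - m) * u) => //.
by rewrite /ofZl rmorphM rmorphXn rmorph_nat exprD mulrA.
Qed.

Lemma padic_ball_refl (x : Ql) m : padic_ball x m x.
Proof. by exists 0 => //; rewrite /ofZl rmorph0 mulr0 addr0. Qed.

Lemma padic_nbhs_filter (x : Ql) : ProperFilter (padic_nbhs x).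
Proof.
split; first by move=> [m /(_ _ (padic_ball_refl x m))].
split.
- by exists 0%N.
- move=> A B [i hA] [j hB]; exists (i + j)%N => y hy; split.
    exact: hA (padic_ballS (leq_addr _ _) hy).
  exact: hB (padic_ballS (leq_addl _ _) hy).
- by move=> A B AB [m hA]; exists m; exact: subset_trans AB.
Qed.

Lemma padic_nbhs_singleton (x : Ql) (A : set Ql) : padic_nbhs x A -> A x.
Proof. by move=> [m]; apply; exact: padic_ball_refl. Qed.

Lemma padic_nbhs_nbhs (x : Ql) (A : set Ql) :
  padic_nbhs x A -> padic_nbhs x (padic_nbhs^~ A).
Proof.
move=> [m hA]; exists m => _ [u _ <-]; exists m => _ [v _ <-]; apply: hA.
by exists (u + v) => //; rewrite /ofZl rmorphD mulrDr addrA.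
Qed.

HB.instance Definition _ := @Nbhs_isNbhsTopological.Build Ql
  padic_nbhs_filter padic_nbhs_singleton padic_nbhs_nbhs.
End Padic.

(* The exponents of Puiseux series in T^(1/N) with poles of order at most B/N. *)
Definition grid (N B k : nat) : rat := (k%:R - B%:R) / N%:R.

Definition gridded (V : nmodType) (N B : nat) (f : rat -> V) : Prop :=
  forall q, f q != 0 -> exists k, q = grid N B k.

(* The ring U_N F((T^(1/N))); [pcoef f q] is the coefficient of T^q. *)
Record puiseux (F : idomainType) := Puiseux {
  pcoef : rat -> F;
  pcoefP : exists N B, (0 < N)%N /\ gridded N B pcoef }.

Section Puiseux.
Variable F : idomainType.
Local Notation P := (puiseux F).
Implicit Types (f g h : rat -> F) (x y z : P) (q : rat).

HB.instance Definition _ := gen_eqMixin P.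
HB.instance Definition _ := gen_choiceMixin P.

Lemma puiseuxP x y : pcoef x =1 pcoef y -> x = y.
Proof.
case: x y => [x hx] [y hy] /= /funext xy; rewrite {x}xy in hx *.
by congr Puiseux; exact: Prop_irrelevance.
Qed.

Lemma gridded_refine (V : nmodType) N B (f : rat -> V) M :
  (0 < M)%N -> gridded N B f -> gridded (N * M) (B * M) f.
Proof.
move=> M0 hf q /hf[k ->]; exists (k * M)%N; rewrite /grid !natrM -mulrBl.
have Mn : M%:R != 0 :> rat by rewrite pnatr_eq0 -lt0n.
by rewrite invfM mulrACA mulfV ?mulr1.
Qed.

Lemma gridded_shift (V : nmodType) N B (f : rat -> V) D :
  gridded N B f -> gridded N (B + D) f.
Proof.
by move=> hf q /hf[k ->]; exists (k + D)%N; rewrite /grid !natrD; congr (_ / _); ring.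
Qed.

Lemma gridded2 x y : exists N B,
  [/\ (0 < N)%N, gridded N B (pcoef x) & gridded N B (pcoef y)].
Proof.
case: x y => [x [N [B [N0 hx]]]] [y [M [D [M0 hy]]]] /=.
exists (N * M)%N, (B * M + D * N)%N; split; first by rewrite muln_gt0 N0.
  exact/gridded_shift/gridded_refine.
by rewrite addnC mulnC; exact/gridded_shift/gridded_refine.
Qed.

Lemma gridded3 x y z : exists N B, [/\ (0 < N)%N, gridded N B (pcoef x),
  gridded N B (pcoef y) & gridded N B (pcoef z)].
Proof.
have [N [B [N0 hx hy]]] := gridded2 x y.
case: z => [z [M [D [M0 hz]]]] /=.
exists (N * M)%N, (B * M + D * N)%N; split; first by rewrite muln_gt0 N0.
- exact/gridded_shift/gridded_refine.
- exact/gridded_shift/gridded_refine.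
- by rewrite addnC mulnC; exact/gridded_shift/gridded_refine.
Qed.

Lemma grid_inj N B : (0 < N)%N -> injective (grid N B).
Proof.
move=> N0 i j /mulIf; rewrite invr_eq0 pnatr_eq0 -lt0n => /(_ N0) /addIr.
by move=> /eqP; rewrite eqr_nat => /eqP.
Qed.

Lemma gridD N B D i j : grid N B i + grid N D j = grid N (B + D) (i + j).
Proof. by rewrite /grid -mulrDl !natrD; congr (_ / _); ring. Qed.

Lemma puiseux_zero_subproof : exists N B, (0 < N)%N /\ gridded N B (fun=> 0 : F).
Proof. by exists 1%N, 0%N; split=> // q; rewrite eqxx. Qed.

Lemma puiseux_add_subproof x y :
  exists N B, (0 < N)%N /\ gridded N B (fun q => pcoef x q + pcoef y q).
Proof.
have [N [B [N0 hx hy]]] := gridded2 x y; exists N, B; split=> // q.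
have [|/hx //] := eqVneq (pcoef x q) 0 => ->; rewrite add0r; exact: hy.
Qed.

Lemma puiseux_opp_subproof x :
  exists N B, (0 < N)%N /\ gridded N B (fun q => - pcoef x q).
Proof.
have [N [B [N0 hx]]] := pcoefP x; exists N, B; split=> // q; rewrite oppr_eq0.
exact: hx.
Qed.

Definition puiseux_zero := Puiseux puiseux_zero_subproof.
Definition puiseux_add x y := Puiseux (puiseux_add_subproof x y).
Definition puiseux_opp x := Puiseux (puiseux_opp_subproof x).

Lemma puiseux_addA : associative puiseux_add.
Proof. by move=> x y z; apply: puiseuxP => q /=; rewrite addrA. Qed.
Lemma puiseux_addC : commutative puiseux_add.
Proof. by move=> x y; apply: puiseuxP => q /=; rewrite addrC. Qed.
Lemma puiseux_add0 : left_id puiseux_zero puiseux_add.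
Proof. by move=> x; apply: puiseuxP => q /=; rewrite add0r. Qed.
Lemma puiseux_addN : left_inverse puiseux_zero puiseux_opp puiseux_add.
Proof. by move=> x; apply: puiseuxP => q /=; rewrite addNr. Qed.

HB.instance Definition _ := GRing.isZmodule.Build P
  puiseux_addA puiseux_addC puiseux_add0 puiseux_addN.

Definition conv f g q : F := \sum_(a \in [set: rat]) f a * g (q - a).

Lemma conv_grid N B D f g k : (0 < N)%N -> gridded N B f -> gridded N D g ->
  conv f g (grid N (B + D) k) =
    \sum_(i < k.+1) f (grid N B i) * g (grid N D (k - i)).
Proof.
move=> N0 hf hg; rewrite /conv.
rewrite (fsbigE [seq grid N B i | i <- iota 0 k.+1]).
- rewrite big_map -[iota 0 k.+1]/(index_iota 0 k.+1) big_mkord.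
  rewrite [LHS](eq_bigl predT); last by move=> i; rewrite in_setT.
  apply: eq_bigr => i _; congr (_ * g _).
  have -> : grid N (B + D) k = grid N B i + grid N D (k - i).
    by rewrite gridD subnKC // -ltnS.
  by rewrite addrAC subrr add0r.
- by rewrite map_inj_uniq ?iota_uniq //; exact: (@grid_inj N B).
- by [].
- move=> a _; apply: contraNeq; rewrite mulf_eq0 negb_or => /andP[/hf[i ->] /hg[j]].
  move=> /(canRL (subrK _)); rewrite addrC gridD => /(grid_inj N0) ->.
  by apply: map_f; rewrite mem_iota; lia.
Qed.

Lemma gridded_conv N B D f g : gridded N B f -> gridded N D g ->
  gridded N (B + D) (conv f g).
Proof.
move=> hf hg q; apply: contra_neqP => hq; apply: fsbig1 => a _.
apply/eqP; apply: contraT; rewrite mulf_eq0 negb_or => /andP[/hf[i ai] /hg[j qa]].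
case: hq; exists (i + j)%N; rewrite -gridD -ai -qa; ring.
Qed.

Lemma puiseux_one_subproof :
  exists N B, (0 < N)%N /\ gridded N B (fun q => (q == 0)%:R : F).
Proof.
exists 1%N, 0%N; split=> // q /=; have [-> _|_] := eqVneq q 0; last by rewrite eqxx.
by exists 0%N; rewrite /grid subr0 mul0r.
Qed.

Lemma puiseux_mul_subproof x y :
  exists N B, (0 < N)%N /\ gridded N B (conv (pcoef x) (pcoef y)).
Proof.
have [N [B [N0 hx hy]]] := gridded2 x y.
by exists N, (B + B)%N; split=> //; exact: gridded_conv.
Qed.

Definition puiseux_one := Puiseux puiseux_one_subproof.
Definition puiseux_mul x y := Puiseux (puiseux_mul_subproof x y).

Lemma gridded_eq N B f g : gridded N B f -> gridded N B g ->
  (forall k, f (grid N B k) = g (grid N B k)) -> f =1 g.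
Proof.
move=> hf hg fg q; have [f0|/hf[k ->] //] := eqVneq (f q) 0.
by have [->//|/hg[k ->]] := eqVneq (g q) 0.
Qed.

Definition trunc N B f k : {poly F} := \poly_(i < k.+1) f (grid N B i).

Lemma conv_trunc N B D f g k j : (0 < N)%N -> gridded N B f -> gridded N D g ->
  (j <= k)%N ->
  conv f g (grid N (B + D) j) = (trunc N B f k * trunc N D g k)`_j.
Proof.
move=> N0 hf hg jk; rewrite conv_grid // coefM; apply: eq_bigr => i _.
have ij := ltn_ord i.
by rewrite !coef_poly !ifT //; lia.
Qed.

Lemma coefM_eq (p p' r r' : {poly F}) k :
  (forall j, (j <= k)%N -> p`_j = p'`_j) ->
  (forall j, (j <= k)%N -> r`_j = r'`_j) -> (p * r)`_k = (p' * r')`_k.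
Proof.
move=> hp hr; rewrite !coefM; apply: eq_bigr => i _.
by have ij := ltn_ord i; rewrite hp ?hr //; lia.
Qed.

Lemma coef_trunc N B f k j : (j <= k)%N -> (trunc N B f k)`_j = f (grid N B j).
Proof. by move=> jk; rewrite coef_poly ltnS jk. Qed.

Lemma puiseux_mulA : associative puiseux_mul.
Proof.
move=> x y z; apply: puiseuxP => /=.
have [N [B [N0 hx hy hz]]] := gridded3 x y z.
have hyz := gridded_conv hy hz; have hxy := gridded_conv hx hy.
apply: (@gridded_eq N (B + (B + B))); first exact: gridded_conv.
  by rewrite addnA; exact: gridded_conv.
move=> k; rewrite (@conv_trunc N B (B + B) _ _ k) // addnA.
rewrite (@conv_trunc N (B + B) B _ _ k) //.
transitivity ((trunc N B (pcoef x) k *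
  (trunc N B (pcoef y) k * trunc N B (pcoef z) k))`_k).
  by apply: coefM_eq => // j jk; rewrite coef_trunc // (@conv_trunc N B B _ _ k).
rewrite mulrA; apply: coefM_eq => // j jk.
by rewrite coef_trunc // (@conv_trunc N B B _ _ k).
Qed.

Lemma puiseux_mulC : commutative puiseux_mul.
Proof.
move=> x y; apply: puiseuxP => /=; have [N [B [N0 hx hy]]] := gridded2 x y.
apply: (@gridded_eq N (B + B)); [exact: gridded_conv | exact: gridded_conv |].
by move=> k; rewrite !(@conv_trunc N B B _ _ k) // mulrC.
Qed.

Lemma puiseux_mul1 : left_id puiseux_one puiseux_mul.
Proof.
move=> x; apply: puiseuxP => q /=; rewrite /conv (fsbigE [:: 0]) //=.
  by rewrite big_cons big_nil in_setT /= ?eqxx mul1r subr0 addr0.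
move=> a _; rewrite inE => /negbTE ->; exact: mul0r.
Qed.

Lemma puiseux_mulD : left_distributive puiseux_mul puiseux_add.
Proof.
move=> x y z; apply: puiseuxP => /=.
have [N [B [N0 hx hy hz]]] := gridded3 x y z.
have hxy : gridded N B (fun q => pcoef x q + pcoef y q).
  move=> q; have [->|/hx//] := eqVneq (pcoef x q) 0; rewrite add0r; exact: hy.
have hxz := gridded_conv hx hz; have hyz := gridded_conv hy hz.
apply: (@gridded_eq N (B + B)); first exact: gridded_conv.
  move=> q; have [->|/hxz//] := eqVneq (conv (pcoef x) (pcoef z) q) 0.
  by rewrite add0r; exact: hyz.
move=> k; rewrite !conv_grid // -big_split; apply: eq_bigr => i _ /=.
by rewrite mulrDl.
Qed.

Lemma puiseux_1neq0 : puiseux_one != 0.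
Proof.
by apply/eqP => /(congr1 (fun x => pcoef x 0)) /eqP /=; rewrite ?eqxx oner_eq0.
Qed.

HB.instance Definition _ := GRing.Zmodule_isComNzRing.Build P
  puiseux_mulA puiseux_mulC puiseux_mul1 puiseux_mulD puiseux_1neq0.

Lemma puiseux_scale_subproof (c : F) x :
  exists N B, (0 < N)%N /\ gridded N B (fun q => c * pcoef x q).
Proof.
have [N [B [N0 hx]]] := pcoefP x; exists N, B; split=> // q.
by rewrite mulf_eq0 negb_or => /andP[_]; exact: hx.
Qed.
Definition puiseux_scale c x := Puiseux (puiseux_scale_subproof c x).

Lemma puiseux_scaleA a b x :
  puiseux_scale a (puiseux_scale b x) = puiseux_scale (a * b) x.
Proof. by apply: puiseuxP => q /=; rewrite mulrA. Qed.
Lemma puiseux_scale1 : left_id 1 puiseux_scale.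
Proof. by move=> x; apply: puiseuxP => q /=; rewrite mul1r. Qed.
Lemma puiseux_scaleDr : right_distributive puiseux_scale +%R.
Proof. by move=> c x y; apply: puiseuxP => q /=; rewrite mulrDr. Qed.
Lemma puiseux_scaleDl x : {morph puiseux_scale^~ x : a b / a + b}.
Proof. by move=> a b; apply: puiseuxP => q /=; rewrite mulrDl. Qed.

HB.instance Definition _ := GRing.Zmodule_isLmodule.Build F P
  puiseux_scaleA puiseux_scale1 puiseux_scaleDr puiseux_scaleDl.

Lemma puiseux_scaleAl (c : F) x y : c *: (x * y) = (c *: x) * y.
Proof.
apply: puiseuxP => q /=; rewrite /conv mulr_fsumr.
by apply: eq_fsbigr => a _; rewrite mulrA.
Qed.

HB.instance Definition _ := GRing.Lmodule_isLalgebra.Build F P puiseux_scaleAl.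
HB.instance Definition _ := GRing.Lalgebra_isComAlgebra.Build F P.

Lemma Tpow_subproof q :
  exists N B, (0 < N)%N /\ gridded N B (fun r => (r == q)%:R : F).
Proof.
exists `|denq q|%N, `|numq q|%N; split; first by rewrite absz_gt0 denq_neq0.
move=> r /=; have [-> _|_] := eqVneq r q; last by rewrite eqxx.
exists `|(`|numq q|%:Z + numq q)%R|%N; rewrite /grid.
rewrite -[LHS]divq_num_den; congr (_ / _); last first.
  by rewrite natr_absz (gtr0_norm (denq_gt0 q)).
rewrite !natr_absz ger0_norm; last by lia.
by rewrite rmorphD /= abszE addrAC subrr add0r.
Qed.

(* T^q *)
Definition Tpow q : P := Puiseux (Tpow_subproof q).

(* f(T) |-> f(T^n), sending T^q to T^(nq) *)
Lemma powmap_subproof n (hn : (0 < n)%N) x :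
  exists N B, (0 < N)%N /\ gridded N B (fun q => pcoef x (q / n%:R)).
Proof.
have [N [B [N0 hx]]] := pcoefP x; exists N, (n * B)%N; split=> // q /hx[k qk].
have n0 : n%:R != 0 :> rat by rewrite pnatr_eq0 -lt0n.
exists (n * k)%N; rewrite -[LHS](divfK n0) qk /grid !natrM -mulrBr.
by rewrite mulrC mulrA.
Qed.
Definition powmap n (hn : (0 < n)%N) x : P := Puiseux (powmap_subproof hn x).

Definition is_pseries x : Prop :=
  forall q, pcoef x q != 0 -> q \is a Num.nat.
End Puiseux.

Definition gbinom (F : fieldType) (r : F) (k : nat) : F :=
  \prod_(i < k) ((r - i%:R) / i.+1%:R).

(* (1 + c T^e)^r = \sum_k gbinom r k * c^k * T^(ke), for e > 0 *)
Lemma binser_subproof (F : fieldType) (e : rat) (r c : F) :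
  exists N B, (0 < N)%N /\ gridded N B (fun q =>
    if (0 < e) && (q / e \is a Num.nat) then
      gbinom r (Num.truncn (q / e)) * c ^+ Num.truncn (q / e) else 0).
Proof.
exists `|denq e|%N, 0%N; split; first by rewrite absz_gt0 denq_neq0.
move=> q; case: ifP => [/andP[e0 /natrP[k qk]] _|]; last by rewrite eqxx.
exists (k * `|numq e|)%N; rewrite /grid subr0 natrM !natr_absz.
rewrite (gtr0_norm (denq_gt0 e)) gtr0_norm ?numq_gt0 // -mulrA divq_num_den -qk.
by rewrite divfK // gt_eqF.
Qed.
Definition binser (F : fieldType) (e : rat) (r c : F) : puiseux F :=
  Puiseux (binser_subproof e r c).

Section Paths.
Variable R : realType.
Local Notation C := R[i].
Local Notation Omega := (puiseux C).

(* e^(2 pi i q) *)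
Definition expi (q : rat) : C :=
  (cos (2 * pi * ratr q) +i* sin (2 * pi * ratr q))%C.

Definition zeta (N : nat) : C := expi N%:R^-1.

(* T^q |-> e^(2 pi i theta q) T^q: continuation along the anticlockwise arc of
   angle 2 pi theta around 0, followed by the rotation back to the direction of
   the positive reals. *)
Lemma rotmap_subproof (theta : rat) (f : Omega) :
  exists N B, (0 < N)%N /\ gridded N B (fun q => expi (theta * q) * pcoef f q).
Proof.
have [N [B [N0 hf]]] := pcoefP f; exists N, B; split=> // q.
by rewrite mulf_eq0 negb_or => /andP[_]; exact: hf.
Qed.
Definition rotmap (theta : rat) (f : Omega) : Omega :=
  Puiseux (rotmap_subproof theta f).

Variable K : divringClosed C.

Definition Kbar : set C :=
  [set x | exists p : {poly C}, [/\ p \is a polyOver K, p != 0 & root p x]].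

(* Elements of Gal(Kbar/K), as functions on C of which only the restriction to
   Kbar matters. *)
Definition in_Gal (sigma : C -> C) : Prop :=
  [/\ set_bij Kbar Kbar sigma,
      forall x, x \in K -> sigma x = x,
      forall x y, Kbar x -> Kbar y -> sigma (x + y) = sigma x + sigma y
    & forall x y, Kbar x -> Kbar y -> sigma (x * y) = sigma x * sigma y].

(* z is a K-point of V_n = P^1 - ({0, oo} U mu_n) *)
Definition Vpoint (n : nat) (z : C) : Prop := [/\ z \in K, z != 0 & z ^+ n != 1].

(* The maximal pro-l extension of Kbar(T) inside Omega. A finite extension embeds
   in a Galois one of l-power degree iff it embeds in the top of a tower of Galois
   extensions of degree l; as Kbar contains mu_l, each step adjoins an l-th root. *)
Inductive in_prol (l : nat) : Omega -> Prop :=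
| prol_const c of Kbar c : in_prol l (c%:A)
| prol_T : in_prol l (Tpow C 1)
| prol_add f g of in_prol l f & in_prol l g : in_prol l (f + g)
| prol_mul f g of in_prol l f & in_prol l g : in_prol l (f * g)
| prol_inv f g of in_prol l f & f * g = 1 : in_prol l g
| prol_root f g of in_prol l f & g ^+ l = f : in_prol l g.

Definition evalT (u : Omega) (P : {poly {poly C}}) : {poly Omega} :=
  map_poly (horner_alg u) P.

(* f is integral over O(V_n (x) Kbar) = Kbar[T, 1/T, 1/(T^n-1)], and
   Kbar(T)(f) is unramified at each point a of V_n: it is a root of a polynomial
   which splits over the completed local ring of power series in T - a. *)
Definition unramified_integral (n : nat) (f : Omega) : Prop :=
  exists P : {poly {poly C}},
    [/\ forall i j, Kbar P`_i`_j,
        forall a, root (lead_coef P) a -> a = 0 \/ a ^+ n = 1,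
        root (evalT (Tpow C 1) P) f
      & forall a, Kbar a -> a != 0 -> a ^+ n != 1 ->
          exists (c : Omega) (rs : seq Omega),
            (forall r, r \in rs -> is_pseries r) /\
            evalT (a%:A + Tpow C 1) P = c *: \prod_(r <- rs) ('X - r%:P)].

(* The ring of functions on the universal pro-l cover of V_n (x) Kbar, pointed
   at the tangential base point 01. *)
Definition univ_ring (l n : nat) : set Omega :=
  [set f | in_prol l f /\ unramified_integral n f].

(* Pro-l etale paths on V_n (x) Kbar from 01 to z. The fibre functor at 01 is
   represented by the universal pro-l cover pointed at 01, so such a path is a
   point of this cover above z; [gamma f] is the value at z of the continuation
   of f along the path, and only its restriction to [univ_ring l n] matters. *)
Definition is_path (l n : nat) (z : C) (gamma : Omega -> C) : Prop :=
  [/\ gamma (Tpow C 1) = z,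
      forall c, Kbar c -> gamma (c%:A) = c,
      forall f g, univ_ring l n f -> univ_ring l n g ->
        gamma (f + g) = gamma f + gamma g
    & forall f g, univ_ring l n f -> univ_ring l n g ->
        gamma (f * g) = gamma f * gamma g].

(* pi_n(gamma), a path from 01 to z^n on V_1 *)
Definition path_pow n (hn : (0 < n)%N) (gamma : Omega -> C) : Omega -> C :=
  fun f => gamma (powmap hn f).

(* delta_zeta j_zeta(gamma), a path from 01 to zeta z on V_1, for
   zeta = e^(2 pi i s/n) *)
Definition path_rot (n s : nat) (gamma : Omega -> C) : Omega -> C :=
  fun f => gamma (rotmap (s%:R / n%:R) f).
End Paths.

Section Characters.
Variables (R : realType) (l : nat) (hl : prime l).
Local Notation C := R[i].
Local Notation Omega := (puiseux C).
Local Notation Zl := (padicint hl).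
Local Notation Ql := (padic hl).
Implicit Types (sigma : C -> C) (gamma : Omega -> C).

(* zeta_{l^m}^x *)
Definition zetapow (m : nat) (x : Zl) : C := zeta R (l ^ m) ^+ res x m.

Definition cyclo sigma : Zl :=
  xget 1 [set x : Zl | forall m, sigma (zeta R (l ^ m)) = zetapow m x].

(* T^(1/l^m) *)
Definition Troot (m : nat) : Omega := Tpow C (l ^ m)%:R^-1.

(* (1 - zeta_{l^m}^x T^(1/l^m))^(1/l^m), the branch equal to 1 at T = 0 *)
Definition one_sub_root (m : nat) (x : Zl) : Omega :=
  binser (l ^ m)%:R^-1 (l ^ m)%:R^-1 (- zetapow m x).

(* rho_w(sigma), where w = gamma T is the end point of gamma *)
Definition kummer gamma sigma : Zl :=
  xget 0 [set x : Zl | forall m,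
    sigma (gamma (Troot m)) = zetapow m x * gamma (Troot m)].

(* The l-adic polylogarithmic character tilde chi_k^{w,gamma}(sigma), k >= 1 *)
Definition polylog_char gamma sigma (k : nat) : Zl :=
  xget 0 [set c : Zl | forall m, zetapow m c =
    sigma (\prod_(a < l ^ m)
      gamma (one_sub_root m ((cyclo sigma)^-1 * a%:R)) ^+ (a ^ k.-1)) /
    \prod_(a < l ^ m)
      gamma (one_sub_root m (a%:R + kummer gamma sigma)) ^+ (a ^ k.-1)].

Definition coset (c : Ql) : set Ql := padic_ball c 0.

Definition compact_open_in (X U : set Ql) : Prop :=
  [/\ U `<=` X, compact U & open U].

(* Z_l-valued measures on X; the values of kappa outside the compact open
   subsets of X are irrelevant. *)
Definition is_measure (X : set Ql) (kappa : set Ql -> Zl) : Prop :=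
  forall U V, compact_open_in X U -> compact_open_in X V ->
    U `&` V = set0 -> kappa (U `|` V) = kappa U + kappa V.

(* \int_{c + Z_l} f dkappa = I, as a limit of Riemann sums *)
Definition has_integral (c : Ql) (kappa : set Ql -> Zl) (f : Ql -> Ql) (I : Ql) :=
  (fun m => \sum_(j < l ^ m)
     f (c + j%:R) * ofZl (kappa (padic_ball (c + j%:R) m))) @ \oo --> I.

(* kappa = kappa_{w,gamma}(sigma), for a pro-l path gamma from 01 to w on V_1 *)
Definition is_KH_measure gamma sigma (kappa : set Ql -> Zl) : Prop :=
  is_measure (coset 0) kappa /\
  forall k, (0 < k)%N ->
    has_integral 0 kappa (fun a => a ^+ k.-1) (ofZl (polylog_char gamma sigma k)).

(* [QPath c gamma] is the Q_l-path x^(-c) . gamma *)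
Record qpath := QPath { qpath_exp : Ql; qpath_path : Omega -> C }.

(* kappa = kappa_{w,p}(sigma), for p = x^(-c) . gamma, c = s/n *)
Definition is_KH_measureQ (p : qpath) sigma (kappa : set Ql -> Zl) : Prop :=
  let: QPath c gamma := p in
  is_measure (coset c) kappa /\
  forall k, (0 < k)%N ->
    has_integral c kappa (fun a => a ^+ k.-1)
      (\sum_(i < k) 'C(k.-1, i)%:R * (c * ofZl (cyclo sigma)) ^+ (k.-1 - i) *
         ofZl (polylog_char gamma sigma i.+1)).

(* epsilon_zeta j_zeta(gamma), zeta = zeta_n^s, epsilon_zeta = x^(-s/n) delta_zeta *)
Definition qpath_rot (n s : nat) gamma : qpath :=
  QPath (s%:R / n%:R) (path_rot n s gamma).

(* [n]_* kappa, for kappa on c + Z_l *)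
Definition pushforward (n : nat) (c : Ql) (kappa : set Ql -> Zl) : set Ql -> Zl :=
  fun U => kappa [set a | coset c a /\ U (n%:R * a)].
End Characters.

(* Main.v *)
(* A Z_l-valued measure on Z_l is determined by its moments, because the indicator
   function of a + l^M Z_l is, modulo any power of l, a polynomial with rational
   coefficients.  By the binomial formula it then suffices to prove the distribution
   relation
     chi_{k+1}^{z^n} = sum_s sum_i C(k,i) n^i (s chi)^(k-i) chi_{i+1}^{zeta_n^s z}.
   Modulo l^m, chi_{k+1} is the sum over a of a^k times a class in Z/l^m measuring the
   action of sigma on the l^m-th root of 1 - zeta_{l^m}^a w^(1/l^m).  The relation
   therefore comes from the factorization
     1 - zeta_{l^m}^b T^(n/l^m) = prod_j (1 - zeta_{n l^m}^j T^(1/l^m)),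
   over j = n a + s with j = b mod l^m, continued along gamma.  As gamma respects products only
   on the universal pro-l cover, one has to see that the l-power roots involved lie in
   it: they are l^r-th roots of polynomials in T^(1/l^m) whose zeros lie over 0 and mu_n. *)
Require Import Defs.
From HB Require Import structures.
From mathcomp Require Import all_boot all_order all_algebra.
From mathcomp Require Import all_classical reals topology trigo.
From mathcomp Require Import complex.
From mathcomp Require Import cyclic zify ring lra.

Set Implicit Arguments.
Unset Strict Implicit.
Unset Printing Implicit Defensive.
Import Order.TTheory GRing.Theory Num.Theory.
Local Open Scope classical_set_scope.
Local Open Scope ring_scope.

(** * Roots of unity *)

(** Membership in the universal pro-l cover asks for an equation over Kbar[T], but the natural one,
    X^(l^r) = F(T^(1/l^m)), has its coefficients in a larger ring. Its norm down to Kbar[T] is used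
    instead. Near a point a of V_n the norm splits because a + T has an l^m-th root among power
    series, and F takes a unit value there, which has an l^r-th root. The integer n may be divisible
    by l, so a |-> n a need not be invertible on Z_l. The argument therefore never divides by n in
    Z_l: sums modulo l^m are regrouped according to the residue of n a + s chi. The shift s chi
    comes from comparing the Kummer cocycles of the two end points. The characters are chosen by
    [xget], with a default value when nothing satisfies their defining property. Each of them has to
    be produced from a compatible system of roots of unity; for chi_k, this compatibility is itself
    a distribution relation, for l in place of n. *)

Lemma prod_one_sub_field (F : fieldType) N (w x : F) : N.-primitive_root w ->
  x != 0 -> \prod_(i < N) (1 - w ^+ i * x) = 1 - x ^+ N.
Proof.
move=> wN x0; have := congr1 (horner^~ x^-1) (factor_Xn_sub_1 wN).
rewrite big_mkord /= horner_prod !hornerE => prodE.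
transitivity (\prod_(i < N) (x * (x^-1 - w ^+ i))).
  by apply: eq_bigr => i _; rewrite mulrBr divff // mulrC.
rewrite big_split prodr_const card_ord /=.
under eq_bigr => i _ do rewrite -[_ - _](hornerXsubC (w ^+ i) x^-1).
by rewrite prodE exprVn mulrBr divff ?expf_neq0 // mulr1.
Qed.

Lemma prod_sub_field (F : fieldType) N (w x y : F) : N.-primitive_root w ->
  x != 0 -> y != 0 -> \prod_(i < N) (x - w ^+ i * y) = x ^+ N - y ^+ N.
Proof.
move=> wN x0 y0; have yx0 : y / x != 0 by rewrite mulf_neq0 ?invr_eq0.
transitivity (\prod_(i < N) (x * (1 - w ^+ i * (y / x)))).
  by apply: eq_bigr => i _; rewrite mulrBr mulr1 mulrCA [x * _]mulrC divfK.
rewrite big_split prodr_const card_ord /= (prod_one_sub_field wN yx0).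
by rewrite mulrBr mulr1 -exprMn mulrC divfK.
Qed.

Section RootsOfUnity.
Variable R : realType.
Local Notation C := R[i].

Lemma expiD (q r : rat) : expi R (q + r) = expi R q * expi R r.
Proof.
rewrite /expi rmorphD mulrDr cosD sinD.
by apply/eqP; rewrite eq_complex /= eqxx /= addrC.
Qed.

Lemma expi0 : expi R 0 = 1.
Proof. by rewrite /expi rmorph0 mulr0 cos0 sin0. Qed.

Lemma expi1 : expi R 1 = 1.
Proof. by rewrite /expi rmorph1 mulr1 mulr_natl cos2pi sin2pi. Qed.

Lemma expiMn (q : rat) k : expi R (k%:R * q) = expi R q ^+ k.
Proof.
elim: k => [|k IH]; first by rewrite mul0r expi0.
by rewrite -natr1 mulrDl mul1r expiD IH exprSr.
Qed.

Lemma expi_nat k : expi R k%:R = 1.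
Proof. by rewrite -[k%:R]mulr1 expiMn expi1 expr1n. Qed.

Lemma expi_neq0 q : expi R q != 0.
Proof.
apply/eqP => q0; have /eqP := expi0.
by rewrite -(subrr q) expiD q0 mul0r eq_sym oner_eq0.
Qed.

(** The real part is 1 - 2 sin(pi q)^2, and sin(pi q) > 0 for 0 < q < 1. *)
Lemma expi_neq1 (q : rat) : 0 < q < 1 -> expi R q != 1.
Proof.
move=> /andP[q0 q1]; rewrite /expi eq_complex negb_and; apply/orP; left => /=.
apply/eqP; rewrite -[X in _ = X]/1.
have -> : 2 * pi * ratr q = (pi * ratr q : R) *+ 2 by rewrite -[RHS]mulr_natl mulrA.
have s0 : 0 < sin (pi * ratr q : R).
  apply: sin_gt0_pi; rewrite mulr_gt0 ?pi_gt0 ?ltr0q //=.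
  by rewrite -[ltRHS]mulr1 ltr_pM2l ?pi_gt0 // -(rmorph1 (@ratr R)) ltr_rat.
rewrite cos_mulr2n => cosE; have := cos2Dsin2 (pi * ratr q : R).
have : 0 < sin (pi * ratr q : R) ^+ 2 by rewrite exprn_gt0.
lra.
Qed.

Lemma zetaX N k : zeta R N ^+ k = expi R (k%:R / N%:R).
Proof. by rewrite -expiMn. Qed.

Lemma zeta_prim N : (0 < N)%N -> N.-primitive_root (zeta R N).
Proof.
move=> N0; have Nn : N%:R != 0 :> rat by rewrite pnatr_eq0 -lt0n.
rewrite /primitive_root_of_unity N0; apply/forallP => /= i.
rewrite unity_rootE zetaX; have [->|iN] := eqVneq i.+1 N.
  by rewrite divff // expi1 eqxx.
apply/eqP/negbTE/expi_neq1; rewrite divr_gt0 ?ltr0n //=.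
by rewrite ltr_pdivrMr ?ltr0n // mul1r ltr_nat ltn_neqAle iN /=.
Qed.

Lemma zetaXM N M k : (0 < M)%N -> zeta R (N * M) ^+ (k * M) = zeta R N ^+ k.
Proof.
move=> M0; have Mn : M%:R != 0 :> rat by rewrite pnatr_eq0 -lt0n.
by rewrite !zetaX !natrM -mulf_div divff // mulr1.
Qed.

Lemma unity_zeta N (x : C) : (0 < N)%N -> x ^+ N = 1 -> exists k, x = zeta R N ^+ k.
Proof.
by move=> N0 /(prim_rootP (zeta_prim N0))[i ->]; exists i.
Qed.

(** [A] may have zero divisors and x, y need not be invertible, so the identity is proved for two
    indeterminates, inside the fraction field of C[Y][X], and then specialized by [psi]. *)
Lemma prod_sub_zeta (A : comNzRingType) (h : {rmorphism C -> A}) (x y : A) N :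
  (0 < N)%N -> \prod_(i < N) (x - h (zeta R N ^+ i) * y) = x ^+ N - y ^+ N.
Proof.
move=> N0; set w := zeta R N.
suff polyE : \prod_(i < N) ('X - (w ^+ i *: 'X)%:P) = 'X^N - ('X^N)%:P :> {poly {poly C}}.
  pose phi : {rmorphism {poly C} -> A} := horner_eval y \o map_poly h.
  pose psi : {rmorphism {poly {poly C}} -> A} := horner_eval x \o map_poly phi.
  have psiX : psi 'X = x by rewrite /= map_polyX /horner_eval hornerX.
  have psiC p : psi p%:P = phi p by rewrite /= map_polyC /horner_eval hornerC.
  have phiX : phi 'X = y by rewrite /= map_polyX /horner_eval hornerX.
  have phiC c : phi c%:P = h c by rewrite /= map_polyC /horner_eval hornerC.
  have := congr1 psi polyE; rewrite rmorphB rmorphXn rmorph_prod psiX psiC rmorphXn phiX.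
  move=> <-; apply: eq_bigr => i _.
  by rewrite rmorphB psiX psiC -mul_polyC rmorphM phiC phiX.
pose iota : {rmorphism C -> {fraction {poly {poly C}}}} :=
  @tofrac {poly {poly C}} \o polyC \o polyC.
have wF : N.-primitive_root (iota w) by rewrite fmorph_primitive_root; exact: zeta_prim.
set X := tofrac ('X : {poly {poly C}}); set Y := tofrac ('X%:P : {poly {poly C}}).
have X0 : X != 0 by rewrite tofrac_eq0 polyX_eq0.
have Y0 : Y != 0 by rewrite tofrac_eq0 polyC_eq0 polyX_eq0.
apply/eqP; rewrite -tofrac_eq; apply/eqP.
rewrite rmorph_prod rmorphB rmorphXn [in RHS]rmorphXn rmorphXn -/X -/Y.
rewrite -(prod_sub_field wF X0 Y0); apply: eq_bigr => i _.
by rewrite rmorphB -mul_polyC 2!rmorphM -(rmorphXn iota).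
Qed.

Lemma prod_one_sub_zeta (A : comAlgType C) (x : A) N : (0 < N)%N ->
  \prod_(i < N) (1 - (zeta R N ^+ i) *: x) = 1 - x ^+ N.
Proof.
move=> N0; have := prod_sub_zeta (in_alg A) 1 x N0; rewrite expr1n => <-.
by apply: eq_bigr => i _; rewrite mulr_algl.
Qed.
End RootsOfUnity.

(** * l-adic integers *)

Section PadicIntegers.
Variables (l : nat) (hl : prime l).
Local Notation Zl := (padicint hl).
Implicit Types x y : Zl.

Lemma resD x y m : res (x + y) m = ((res x m + res y m) %% l ^ m)%N.
Proof. by []. Qed.

Lemma resM x y m : res (x * y) m = ((res x m * res y m) %% l ^ m)%N.
Proof. by []. Qed.

Lemma res0 m : res (0 : Zl) m = 0%N.
Proof. by rewrite /= mod0n. Qed.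

Lemma res_nat k m : res (k%:R : Zl) m = (k %% l ^ m)%N.
Proof.
elim: k => [|k IH]; first by rewrite res0 mod0n.
by rewrite -addn1 natrD resD IH /= modnDm.
Qed.

Lemma resX x k m : res (x ^+ k) m = (res x m ^ k %% l ^ m)%N.
Proof.
elim: k => [|k IH]; first by rewrite expr0 (res_nat 1).
by rewrite exprS resM IH modnMmr expnS.
Qed.

Lemma res_res x m k : (m <= k)%N -> res ((res x k)%:R : Zl) m = res x m.
Proof. by move=> mk; rewrite res_nat res_le. Qed.

Lemma eq_resD x x' y y' m : res x m = res x' m -> res y m = res y' m ->
  res (x + y) m = res (x' + y') m.
Proof. by rewrite !resD => -> ->. Qed.

Lemma eq_resM x x' y y' m : res x m = res x' m -> res y m = res y' m ->
  res (x * y) m = res (x' * y') m.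
Proof. by rewrite !resM => -> ->. Qed.

Lemma eq_resX x y k m : res x m = res y m -> res (x ^+ k) m = res (y ^+ k) m.
Proof. by rewrite !resX => ->. Qed.

Lemma eq_res_sum (I : Type) (s : seq I) (P : pred I) (F G : I -> Zl) m :
  (forall i, P i -> res (F i) m = res (G i) m) ->
  res (\sum_(i <- s | P i) F i) m = res (\sum_(i <- s | P i) G i) m.
Proof.
move=> FG; apply: (big_rec2 (fun x y => res x m = res y m)) => // i x y /FG.
exact: eq_resD.
Qed.

Lemma res_sum_eq0 (I : Type) (s : seq I) (P : pred I) (F : I -> Zl) m :
  (forall i, P i -> res (F i) m = 0%N) -> res (\sum_(i <- s | P i) F i) m = 0%N.
Proof.
move=> F0; elim/big_ind: _ => //; first exact: res0.
by move=> x y; rewrite resD => -> ->; rewrite mod0n.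
Qed.

Lemma eq_res_le x y m k : (m <= k)%N -> res x k = res y k -> res x m = res y m.
Proof. by move=> mk xy; rewrite -(res_le x mk) xy res_le. Qed.

Lemma res_sub_eq0 x y m : res (x - y) m = 0%N <-> res x m = res y m.
Proof.
split=> xy; last by rewrite -(res0 m) -(subrr y); exact: eq_resD.
rewrite -[x](subrK y) -[in RHS](add0r y); apply: eq_resD => //.
by rewrite xy res0.
Qed.

(* The quotient by l^m of a multiple of l^m has residues [res x (m + k) %/ l ^ m]. *)
Lemma res_eq0P x m : res x m = 0%N <-> exists u : Zl, x = (l ^ m)%:R * u.
Proof.
split=> [x0|[u ->]]; last by rewrite resM res_nat modnn mul0n mod0n.
have dvd k : (l ^ m %| res x (m + k))%N.
  by rewrite /dvdn res_le ?leq_addr // x0.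
have quo_compat k : (res x (m + k) %/ l ^ m)%N =
    (res x (m + k.+1) %/ l ^ m)%N %[mod l ^ k].
  have le_mk : (m + k <= m + k.+1)%N by rewrite leq_add2l.
  rewrite -(res_le x le_mk).
  rewrite addnS -addnS expnD mulnC -modn_divl ?expl_gt0 // modn_mod.
  by congr (_ %% _)%N; rewrite mulnC.
exists (mkpadic hl quo_compat); apply: padicP => k.
rewrite resM res_nat modnMml.
have -> : res (mkpadic hl quo_compat) k = ((res x (m + k) %/ l ^ m) %% l ^ k)%N by [].
by rewrite modnMmr mulnC divnK ?dvd // res_le ?leq_addl.
Qed.

Lemma padic_natr_inj : injective (fun k : nat => k%:R : Zl).
Proof.
move=> i j /= /(congr1 (fun x => res x (i + j)%N)); rewrite !res_nat !modn_small //.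
  by apply: leq_ltn_trans (leq_addl i j) _; rewrite ltn_expl ?prime_gt1.
by apply: leq_ltn_trans (leq_addr j i) _; rewrite ltn_expl ?prime_gt1.
Qed.

Lemma padic_natr_neq0 k : (0 < k)%N -> k%:R != 0 :> Zl.
Proof.
by move=> k0; rewrite -[0]/(0%:R); apply: contraTneq k0 => /padic_natr_inj ->.
Qed.

Lemma affine_res_inj (u v : Zl) m : u \is a GRing.unit ->
  injective (fun a : 'I_(l ^ m) => Ordinal (res_lt (u * (val a)%:R + v) m)).
Proof.
move=> uU a b /(congr1 val) /= ab; apply: val_inj.
have /res_sub_eq0 : res (u * (val a)%:R + v) m = res (u * (val b)%:R + v) m by [].
rewrite opprD addrACA subrr addr0 -mulrBr => h.
have /res_sub_eq0 : res ((val a)%:R - (val b)%:R : Zl) m = 0%N.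
  rewrite -[_ - _](mulKr uU) -(res0 m) -(mulr0 u^-1).
  by apply: eq_resM => //; rewrite h res0.
by rewrite !res_nat !modn_small ?ltn_ord.
Qed.

(* a |-> u a + v permutes Z/l^m. *)
Lemma reindex_affine (A : Type) (idx : A) (op : Monoid.com_law idx) (u v : Zl) m
    (P : Zl -> bool) (G : Zl -> A) : u \is a GRing.unit ->
  (forall x y, res x m = res y m -> P x = P y /\ G x = G y) ->
  \big[op/idx]_(a < l ^ m | P a%:R) G a%:R =
  \big[op/idx]_(a < l ^ m | P (u * a%:R + v)) G (u * a%:R + v).
Proof.
move=> uU PG; rewrite (reindex_inj (affine_res_inj (v := v) uU)) /=.
have PGE (a : 'I_(l ^ m)) := PG _ (u * a%:R + v) (res_res (u * a%:R + v) (leqnn m)).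
by apply: eq_big => [a|a _]; case: (PGE a).
Qed.

Section Zetapow.
Variable R : realType.
Local Notation C := R[i].
Local Notation zetapow := (@zetapow R l hl).

Lemma zetapow_primroot m : (l ^ m).-primitive_root (zeta R (l ^ m)).
Proof. by apply: zeta_prim; exact: expl_gt0. Qed.

Lemma zetapow_res m x : zetapow m x = zeta R (l ^ m) ^+ res x m.
Proof. by []. Qed.

Lemma zetapowE m x k : res x m = k %[mod l ^ m] -> zetapow m x = zeta R (l ^ m) ^+ k.
Proof.
have prim := zetapow_primroot m.
by move=> xk; rewrite /zetapow -(prim_expr_mod prim) xk prim_expr_mod.
Qed.

Lemma zetapow_nat m k : zetapow m k%:R = zeta R (l ^ m) ^+ k.
Proof. by apply: zetapowE; rewrite res_nat modn_mod. Qed.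

Lemma zetapowD m x y : zetapow m (x + y) = zetapow m x * zetapow m y.
Proof. by rewrite (@zetapowE _ _ (res x m + res y m)) ?exprD // resD modn_mod. Qed.

Lemma zetapowM m x y : zetapow m (x * y) = zetapow m x ^+ res y m.
Proof. by rewrite (@zetapowE _ _ (res x m * res y m)) ?exprM // resM modn_mod. Qed.

Lemma zetapow0 m : zetapow m 0 = 1.
Proof. by rewrite /zetapow res0 expr0. Qed.

Lemma zetapow_order m x : zetapow m x ^+ (l ^ m) = 1.
Proof. by rewrite exprAC (prim_expr_order (zetapow_primroot m)) expr1n. Qed.

Lemma zetapowMn m x k : zetapow m (x * k%:R) = zetapow m x ^+ k.
Proof. by rewrite zetapowM res_nat expr_mod // zetapow_order. Qed.

Lemma zetapow_sum (I : Type) (s : seq I) (P : pred I) (F : I -> Zl) m :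
  zetapow m (\sum_(i <- s | P i) F i) = \prod_(i <- s | P i) zetapow m (F i).
Proof. exact: (big_morph _ (zetapowD m) (zetapow0 m)). Qed.

Lemma zetapow_eq m x y : zetapow m x = zetapow m y <-> res x m = res y m.
Proof.
split=> [/eqP|]; last by rewrite /zetapow => ->.
by rewrite (eq_prim_root_expr (zetapow_primroot m)) !res_small => /eqP.
Qed.

Lemma zetapow_inj x y : (forall m, zetapow m x = zetapow m y) -> x = y.
Proof. by move=> xy; apply: padicP => m; apply/zetapow_eq. Qed.

(** This yields the witnesses that keep [cyclo], [kummer] and [polylog_char] from taking their
    default values. *)
Lemma tate_module (e : nat -> C) :
  (forall m, e m ^+ (l ^ m) = 1) -> (forall m, e m.+1 ^+ l = e m) ->
  exists x, forall m, e m = zetapow m x.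
Proof.
move=> e1 eS.
have /boolp.choice[k ek] : forall m, exists k, e m = zeta R (l ^ m) ^+ k.
  by move=> m; apply: unity_zeta; [exact: expl_gt0|exact: e1].
have k_compat m : k m = k m.+1 %[mod l ^ m].
  apply/eqP; rewrite -(eq_prim_root_expr (zetapow_primroot m)) -ek -eS ek -exprM.
  by rewrite (expnSr l m) zetaXM ?prime_gt0.
exists (mkpadic hl k_compat) => m.
by rewrite ek; apply/esym/zetapowE; rewrite /= modn_mod.
Qed.
End Zetapow.
End PadicIntegers.

(** * Puiseux series *)

Section PuiseuxSeries.
Variable F : numFieldType.
Local Notation P := (puiseux F).
Implicit Types (x y : P) (e q r : rat) (c s t : F).

(** On these series the constant coefficient is multiplicative, so it can single out one branch of a
    root. *)
Definition nonneg_supp x := exists N, (0 < N)%N /\ gridded N 0 (pcoef x).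

Lemma nonneg_supp2 x y : nonneg_supp x -> nonneg_supp y ->
  exists N, [/\ (0 < N)%N, gridded N 0 (pcoef x) & gridded N 0 (pcoef y)].
Proof.
move=> [N [N0 hx]] [M [M0 hy]]; exists (N * M)%N; split; first by rewrite muln_gt0 N0.
  exact: (gridded_refine M0 hx).
by rewrite mulnC; exact: (gridded_refine N0 hy).
Qed.

Lemma grid00 N : grid N 0 0 = 0.
Proof. by rewrite /grid subrr mul0r. Qed.

Lemma nonneg_supp1 : nonneg_supp 1.
Proof.
exists 1%N; split=> // q /=; have [->|_] := eqVneq q 0; last by rewrite eqxx.
by exists 0%N; rewrite grid00.
Qed.

Lemma nonneg_suppD x y : nonneg_supp x -> nonneg_supp y -> nonneg_supp (x + y).
Proof.
move=> /nonneg_supp2 xy /xy[N [N0 hx hy]]; exists N; split=> // q /=.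
have [->|/hx//] := eqVneq (pcoef x q) 0; rewrite add0r; exact: hy.
Qed.

Lemma nonneg_suppZ c x : nonneg_supp x -> nonneg_supp (c *: x).
Proof.
move=> [N [N0 hx]]; exists N; split=> // q /=.
by rewrite mulf_eq0 negb_or => /andP[_ /hx].
Qed.

Lemma nonneg_suppN x : nonneg_supp x -> nonneg_supp (- x).
Proof. by rewrite -scaleN1r; exact: nonneg_suppZ. Qed.

Lemma nonneg_suppM x y : nonneg_supp x -> nonneg_supp y -> nonneg_supp (x * y).
Proof.
move=> /nonneg_supp2 xy /xy[N [N0 hx hy]]; exists N; split=> //.
exact: (gridded_conv hx hy).
Qed.

Lemma nonneg_supp_prod (I : Type) (s : seq I) (G : I -> P) :
  (forall i, nonneg_supp (G i)) -> nonneg_supp (\prod_(i <- s) G i).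
Proof.
by move=> hG; elim/big_ind: _ => //; [exact: nonneg_supp1|exact: nonneg_suppM].
Qed.

Lemma nonneg_suppX x n : nonneg_supp x -> nonneg_supp (x ^+ n).
Proof.
move=> hx; elim: n => [|n IH]; first exact: nonneg_supp1.
by rewrite exprS; exact: nonneg_suppM.
Qed.

Lemma pcoef0M x y : nonneg_supp x -> nonneg_supp y ->
  pcoef (x * y) 0 = pcoef x 0 * pcoef y 0.
Proof.
move=> /nonneg_supp2 xy /xy[N [N0 hx hy]].
have := conv_grid 0 N0 hx hy; rewrite big_ord1 !grid00 => <- //.
Qed.

Lemma pcoef01 : pcoef (1 : P) 0 = 1.
Proof. by []. Qed.

Lemma pcoef0X x n : nonneg_supp x -> pcoef (x ^+ n) 0 = pcoef x 0 ^+ n.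
Proof.
move=> hx; elim: n => [|n IH]; first by rewrite !expr0 pcoef01.
by rewrite !exprS pcoef0M ?IH //; exact: nonneg_suppX.
Qed.

Lemma pcoef0_prod (I : Type) (s : seq I) (G : I -> P) :
  (forall i, nonneg_supp (G i)) ->
  pcoef (\prod_(i <- s) G i) 0 = \prod_(i <- s) pcoef (G i) 0.
Proof.
move=> hG; elim: s => [|i s IH]; first by rewrite !big_nil pcoef01.
by rewrite !big_cons pcoef0M ?IH //; exact: nonneg_supp_prod.
Qed.

Lemma pcoef_sum (I : Type) (s : seq I) (G : I -> P) q :
  pcoef (\sum_(i <- s) G i) q = \sum_(i <- s) pcoef (G i) q.
Proof. exact: (big_morph (fun x => pcoef x q)). Qed.

(** Cancellation of a factor with nonzero constant term: the coefficients of [y] vanish one after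
    the other. *)
Lemma mul_nonneg_supp_eq0 x y : nonneg_supp x -> nonneg_supp y ->
  pcoef x 0 != 0 -> y * x = 0 -> y = 0.
Proof.
move=> hx hy x0; have [N [N0 {}hx {}hy]] := nonneg_supp2 hx hy.
move=> yx0; apply: puiseuxP; apply: (gridded_eq (N := N) (B := 0)) => //.
  by move=> q /=; rewrite eqxx.
move=> k; elim/ltn_ind: k => k IH.
have := conv_grid k N0 hy hx; rewrite -[conv _ _]/(pcoef (y * x)) yx0.
rewrite big_ord_recr /= subnn grid00 big1 => [/esym/eqP|i _]; last first.
  by rewrite IH //= mul0r.
by rewrite add0r mulf_eq0 (negPf x0) orbF => /eqP.
Qed.

(** x^n - y^n is x - y times a sum of n terms with constant coefficient 1, and n is nonzero in
    characteristic 0. *)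
Lemma root_unique x y n : (0 < n)%N -> nonneg_supp x -> nonneg_supp y ->
  pcoef x 0 = 1 -> pcoef y 0 = 1 -> x ^+ n = y ^+ n -> x = y.
Proof.
move=> n0 hx hy x0 y0 xyn; apply/eqP; rewrite -subr_eq0; apply/eqP.
have hterm (i : 'I_n) : nonneg_supp (x ^+ (n.-1 - i) * y ^+ i).
  by apply: nonneg_suppM; exact: nonneg_suppX.
apply: (@mul_nonneg_supp_eq0 (\sum_(i < n) x ^+ (n.-1 - i) * y ^+ i)).
- by elim/big_ind: _ => //; [exists 1%N; split=> // q; rewrite eqxx|exact: nonneg_suppD].
- exact: nonneg_suppD (nonneg_suppN _).
- rewrite pcoef_sum (eq_bigr (fun=> 1)) => [|i _].
    by rewrite sumr_const card_ord pnatr_eq0 -lt0n.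
  rewrite pcoef0M; [|exact: nonneg_suppX..].
  by rewrite !pcoef0X // x0 y0 !expr1n mulr1.
- by rewrite -subrXX xyn subrr.
Qed.

Lemma conv_ray e (f g : rat -> F) k : 0 < e ->
  (forall q, f q != 0 -> exists i, q = i%:R * e) ->
  (forall q, g q != 0 -> exists i, q = i%:R * e) ->
  conv f g (k%:R * e) = \sum_(i < k.+1) f (i%:R * e) * g ((k - i)%:R * e).
Proof.
move=> e0 hf hg; rewrite /conv.
have ray_inj : injective (fun i : nat => i%:R * e).
  by move=> i j /= /mulIf; rewrite gt_eqF // => /(_ isT) /eqP; rewrite eqr_nat => /eqP.
rewrite (fsbigE [seq i%:R * e | i <- iota 0 k.+1]).
- rewrite big_map -[iota 0 k.+1]/(index_iota 0 k.+1) big_mkord.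
  rewrite [LHS](eq_bigl predT); last by move=> i; rewrite in_setT.
  apply: eq_bigr => i _; congr (_ * g _).
  by rewrite natrB -1?ltnS // mulrBl.
- by rewrite map_inj_uniq ?iota_uniq.
- by [].
- move=> a _; apply: contraNeq; rewrite mulf_eq0 negb_or => /andP[/hf[i ->] /hg[j]].
  move=> /(canRL (subrK _)); rewrite -mulrDl -natrD => /ray_inj kE.
  by apply: (map_f (fun i : nat => i%:R * e)); rewrite mem_iota; lia.
Qed.

Lemma gbinom0 s : gbinom s 0 = 1.
Proof. by rewrite /gbinom big_ord0. Qed.

Lemma gbinomS s k : k.+1%:R * gbinom s k.+1 = (s - k%:R) * gbinom s k.
Proof.
rewrite /gbinom big_ord_recr /=; set X := \prod_(i < k) _.
by rewrite mulrCA [_ / _]mulrC mulVKf ?pnatr_eq0 // mulrC.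
Qed.

(* Chu-Vandermonde; both sides satisfy the recursion (k + 1) V_{k+1} = (s + t - k) V_k. *)
Lemma gbinomD s t k :
  \sum_(i < k.+1) gbinom s i * gbinom t (k - i) = gbinom (s + t) k.
Proof.
elim: k => [|k IH]; first by rewrite big_ord1 !gbinom0 mulr1.
apply: (mulfI (x := k.+1%:R)); first by rewrite pnatr_eq0.
rewrite gbinomS -IH !mulr_sumr.
transitivity (\sum_(i < k.+2) i%:R * gbinom s i * gbinom t (k.+1 - i) +
              \sum_(i < k.+2) gbinom s i * ((k.+1 - i)%:R * gbinom t (k.+1 - i))).
  rewrite -big_split; apply: eq_bigr => -[i /= ik] _.
  have -> : k.+1%:R = i%:R + (k.+1 - i)%:R :> F by rewrite -natrD subnKC.
  ring.
rewrite big_ord_recl !mul0r add0r [X in _ + X]big_ord_recr /= subnn mul0r mulr0 addr0.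
rewrite -big_split; apply: eq_bigr => -[i /= ik] _.
rewrite /bump /= add1n subSS gbinomS subSn -1?ltnS // gbinomS natrB -1?ltnS //.
ring.
Qed.

Lemma binser_ray e s c : 0 < e -> forall q, pcoef (binser e s c) q != 0 ->
  exists i, q = i%:R * e.
Proof.
move=> e0 q /=; rewrite e0 /=; case: natrP => [[i qi] _|]; last by rewrite eqxx.
by exists i; rewrite -qi divfK // gt_eqF.
Qed.

Lemma pcoef_binser e s c k : 0 < e -> pcoef (binser e s c) (k%:R * e) = gbinom s k * c ^+ k.
Proof. by move=> e0; rewrite /= e0 mulfK ?gt_eqF // natr_nat natrK. Qed.

Lemma ray_eq e x y : 0 < e -> (forall q, pcoef x q != 0 -> exists i, q = i%:R * e) ->
  (forall q, pcoef y q != 0 -> exists i, q = i%:R * e) ->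
  (forall k, pcoef x (k%:R * e) = pcoef y (k%:R * e)) -> x = y.
Proof.
move=> e0 hx hy xy; apply: puiseuxP => q.
have [x0|/hx[k ->]//] := eqVneq (pcoef x q) 0.
by have [->//|/hy[k ->]] := eqVneq (pcoef y q) 0.
Qed.

(** The coefficientwise form of this is the Chu-Vandermonde identity [gbinomD]. *)
Lemma binserD e s t c : 0 < e -> binser e s c * binser e t c = binser e (s + t) c.
Proof.
move=> e0; have hs := @binser_ray e s c e0; have ht := @binser_ray e t c e0.
apply: (ray_eq e0) => [q|q|k]; last 1 first.
- rewrite pcoef_binser // -gbinomD mulr_suml [LHS](conv_ray k e0 hs ht).
  apply: eq_bigr => -[i ik] _; rewrite !pcoef_binser //.
  by rewrite mulrACA -exprD subnKC.
- apply: contra_neqP => hq; apply: fsbig1 => a _.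
  apply/eqP; apply: contraT; rewrite mulf_eq0 negb_or => /andP[/hs[i ai] /ht[j qa]].
  by case: hq; exists (i + j)%N; rewrite natrD mulrDl -ai -qa addrC subrK.
- exact: binser_ray.
Qed.

Lemma ray1 e : forall q, pcoef (1 : P) q != 0 -> exists i, q = i%:R * e.
Proof.
move=> q /=; have [->|_] := eqVneq q 0; last by rewrite eqxx.
by exists 0%N; rewrite mul0r.
Qed.

Lemma binser0 e c : 0 < e -> binser e 0 c = 1.
Proof.
move=> e0; apply: (ray_eq e0 (@binser_ray _ _ _ e0) (ray1 e)) => k.
rewrite pcoef_binser //=. rewrite mulf_eq0 (gt_eqF e0) orbF pnatr_eq0.
case: k => [|k]; first by rewrite gbinom0 mulr1.
by rewrite /gbinom big_ord_recl /= subrr !mul0r.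
Qed.

Lemma binser1 e c : 0 < e -> binser e 1 c = 1 + c *: Tpow F e.
Proof.
move=> e0; apply: (ray_eq e0 (@binser_ray _ _ _ e0)) => [q|k].
  have [qe _|qe] := eqVneq q e; first by exists 1%N; rewrite mul1r.
  by rewrite /= (negPf qe) mulr0 addr0; exact: ray1.
have k0E : (k%:R * e == 0) = (k == 0)%N by rewrite mulf_eq0 (gt_eqF e0) orbF pnatr_eq0.
have k1E : (k%:R * e == e) = (k == 1)%N.
  by rewrite -[X in _ == X]mul1r (inj_eq (mulIf (negbT (gt_eqF e0)))) -[1]/(1%:R) eqr_nat.
rewrite pcoef_binser //= k0E k1E.
case: k {k0E k1E} => [|[|k]]; rewrite /= ?mulr0 ?addr0.
- by rewrite gbinom0 mulr1.
- by rewrite /gbinom big_ord1 subr0 divr1 mul1r expr1 add0r mulr1.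
- by rewrite /gbinom !big_ord_recl /= subrr mul0r mul0r mulr0 mul0r.
Qed.

Lemma binserX e s c n : 0 < e -> binser e s c ^+ n = binser e (n%:R * s) c.
Proof.
move=> e0; elim: n => [|n IH]; first by rewrite expr0 mul0r binser0.
by rewrite exprS IH binserD // -[in RHS]natr1 mulrDl mul1r addrC.
Qed.

Lemma binser_root e c n : 0 < e -> (0 < n)%N ->
  binser e n%:R^-1 c ^+ n = 1 + c *: Tpow F e.
Proof.
by move=> e0 n0; rewrite binserX // divff ?binser1 // pnatr_eq0 -lt0n.
Qed.

Lemma nonneg_supp_binser e s c : 0 < e -> nonneg_supp (binser e s c).
Proof.
move=> e0; exists `|denq e|%N; split; first by rewrite absz_gt0 denq_neq0.
move=> q /(binser_ray e0)[k ->]; exists (k * `|numq e|)%N.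
rewrite /grid subr0 natrM !natr_absz (gtr0_norm (denq_gt0 e)) gtr0_norm ?numq_gt0 //.
by rewrite -mulrA divq_num_den.
Qed.

Lemma pcoef0_binser e s c : 0 < e -> pcoef (binser e s c) 0 = 1.
Proof. by move=> e0; rewrite -(mul0r e) (pcoef_binser s c 0) // gbinom0 mulr1. Qed.

Lemma TpowD q r : Tpow F q * Tpow F r = Tpow F (q + r).
Proof.
apply: puiseuxP => a /=; rewrite /conv (fsbigE [:: q]) //=.
  by rewrite big_cons big_nil in_setT eqxx mul1r addr0 subr_eq addrC.
by move=> b _; rewrite inE => /negbTE ->; rewrite mul0r.
Qed.

Lemma Tpow0 : Tpow F 0 = 1.
Proof. exact: puiseuxP. Qed.

Lemma TpowX q n : Tpow F q ^+ n = Tpow F (n%:R * q).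
Proof.
elim: n => [|n IH]; first by rewrite expr0 mul0r Tpow0.
by rewrite exprS IH TpowD -[in RHS]natr1 mulrDl mul1r addrC.
Qed.

Lemma powmap_Tpow n (hn : (0 < n)%N) q : powmap hn (Tpow F q) = Tpow F (n%:R * q).
Proof.
have n0 : n%:R != 0 :> rat by rewrite pnatr_eq0 -lt0n.
apply: puiseuxP => r /=; congr (_%:R); congr nat_of_bool.
by apply/eqP/eqP => [<-|->]; [rewrite mulrC divfK|rewrite mulrC mulKf].
Qed.

Lemma powmap_binser n (hn : (0 < n)%N) e s c :
  powmap hn (binser e s c) = binser (n%:R * e) s c.
Proof.
have n0 : 0 < n%:R :> rat by rewrite ltr0n.
apply: puiseuxP => q /=; rewrite pmulr_rgt0 //.
by rewrite invfM mulrA.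
Qed.
End PuiseuxSeries.

Section PuiseuxRotation.
Variable R : realType.
Local Notation C := R[i].

Lemma rotmap_Tpow theta q : rotmap theta (Tpow C q) = expi R (theta * q) *: Tpow C q.
Proof.
by apply: puiseuxP => r /=; have [->//|_] := eqVneq r q; rewrite !mulr0.
Qed.

Lemma rotmap_binser theta e (s c : C) : 0 < e ->
  rotmap theta (binser e s c) = binser e s (expi R (theta * e) * c).
Proof.
move=> e0; apply: (ray_eq e0) => [q|q|k].
- by rewrite /= mulf_eq0 negb_or => /andP[_]; exact: binser_ray.
- exact: binser_ray.
rewrite pcoef_binser // -[LHS]/(_ * pcoef (binser e s c) _) pcoef_binser //.
by rewrite exprMn -expiMn mulrCA; congr (_ * (expi R _ * _)); ring.
Qed.

(* Both sides are the [L]-th root of 1 - c^N T^(Ne) with constant coefficient 1. *)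
Lemma prod_binser e (c : C) N L : 0 < e -> (0 < N)%N -> (0 < L)%N ->
  \prod_(j < N) binser e L%:R^-1 (- (zeta R N ^+ j * c)) =
  binser (N%:R * e) L%:R^-1 (- c ^+ N).
Proof.
move=> e0 N0 L0; have Ne0 : 0 < N%:R * e by rewrite mulr_gt0 ?ltr0n.
apply: (root_unique L0).
- by apply: nonneg_supp_prod => i; exact: nonneg_supp_binser.
- exact: nonneg_supp_binser.
- rewrite pcoef0_prod => [|i]; last exact: nonneg_supp_binser.
  by rewrite big1 // => i _; rewrite pcoef0_binser.
- by rewrite pcoef0_binser.
rewrite -prodrXl binser_root // scaleNr -TpowX -exprZn.
rewrite -(prod_one_sub_zeta _ N0); apply: eq_bigr => i _.
by rewrite binser_root // scaleNr scalerA.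
Qed.
End PuiseuxRotation.

(** * Descent of norms and roots of power series *)

Section AlgebraicClosure.
Variables (R : realType) (K : divringClosed R[i]).
Local Notation C := R[i].
Local Notation Kbar := (Kbar K).

(** Turning K into a field with a morphism to C makes [Kbar] a set of integral elements, whose
    closure properties then apply. *)
Definition base_field := {x : C | x \in K}.
HB.instance Definition _ := SubChoice.on base_field.
HB.instance Definition _ := [SubChoice_isSubIntegralDomain of base_field by <:].
HB.instance Definition _ := [SubIntegralDomain_isSubField of base_field by <:].
Definition base_val : {rmorphism base_field -> C} := val.

Lemma KbarP x : Kbar x <-> integralOver base_val x.
Proof.
rewrite -integral_algebraic; split=> [[p [pK p0 px]]|[q q0 qx]].
  pose q : {poly base_field} := \poly_(i < size p) insubd 0 p`_i.
  have qE : map_poly base_val q = p.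
    apply/polyP => i; rewrite coef_map coef_poly; case: ltnP => [ip|pi].
      exact: (insubdK (0 : base_field) (polyOverP pK i)).
    by rewrite nth_default //; exact: (rmorph0 base_val).
  by exists q; rewrite ?qE //; apply: contra_neq p0 => q0; rewrite -qE q0 rmorph0.
exists (map_poly base_val q); split=> //; last by rewrite map_poly_eq0.
by apply/polyOverP => i; rewrite coef_map; exact: valP.
Qed.

Definition Kbar_pred : {pred C} := [pred x | `[< Kbar x >]].

Lemma Kbar_subring : subring_closed Kbar_pred.
Proof.
split; first by apply/asboolP/KbarP; exact: integral1.
  by move=> x y /asboolP/KbarP hx /asboolP/KbarP hy; apply/asboolP/KbarP; exact: integral_sub.
by move=> x y /asboolP/KbarP hx /asboolP/KbarP hy; apply/asboolP/KbarP; exact: integral_mul.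
Qed.
HB.instance Definition _ := GRing.isSubringClosed.Build C Kbar_pred Kbar_subring.

Lemma KbarK x : x \in K -> Kbar x.
Proof. by move=> xK; apply/KbarP; exact: (integral_id base_val (exist _ x xK : base_field)). Qed.

Lemma Kbar1 : Kbar 1.
Proof. by apply/asboolP; exact: (rpred1 Kbar_pred). Qed.

Lemma KbarB x y : Kbar x -> Kbar y -> Kbar (x - y).
Proof.
by move=> /asboolP hx /asboolP hy; apply/asboolP; exact: (rpredB (S := Kbar_pred) hx hy).
Qed.

Lemma KbarM x y : Kbar x -> Kbar y -> Kbar (x * y).
Proof.
by move=> /asboolP hx /asboolP hy; apply/asboolP; exact: (rpredM (s := Kbar_pred) hx hy).
Qed.

Lemma KbarX x n : Kbar x -> Kbar (x ^+ n).
Proof. by move=> hx; elim: n => [|n IH]; [exact: Kbar1|rewrite exprS; exact: KbarM]. Qed.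

Lemma Kbar_root x n : (0 < n)%N -> Kbar (x ^+ n) -> Kbar x.
Proof.
move=> n0 /KbarP hx; apply/KbarP.
apply: (@integral_root _ _ _ ('X^n - (x ^+ n)%:P)).
- by rewrite -size_poly_gt0 size_XnsubC.
- by rewrite rootE !hornerE subrr.
move=> y /(nthP 0)[i _ <-]; rewrite coefB coefXn coefC.
by apply: integral_sub; [exact: integral_nat|case: eqP => _ //; exact: integral0].
Qed.

Lemma Kbar_unity x n : (0 < n)%N -> x ^+ n = 1 -> Kbar x.
Proof. by move=> n0 xn; apply: (Kbar_root n0); rewrite xn; exact: Kbar1. Qed.
End AlgebraicClosure.

Section Descent.
Variable R : realType.
Local Notation C := R[i].

Lemma coef_comp_scale (c : C) (p : {poly C}) j : (p \Po (c *: 'X))`_j = p`_j * c ^+ j.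
Proof.
have -> : p \Po (c *: 'X) = \poly_(i < size p) (p`_i * c ^+ i).
  by rewrite comp_polyE poly_def; apply: eq_bigr => i _; rewrite exprZn scalerA.
by rewrite coef_poly; case: ltnP => // pj; rewrite nth_default // mul0r.
Qed.

(** A left inverse of the substitution of S^M for S; only the coefficients at multiples of M are
    kept. *)
Definition decimate M (p : {poly C}) : {poly C} := \poly_(j < size p) p`_(j * M).

(** Invariance under S |-> w S gives p_j w^j = p_j, so p_j = 0 unless M divides j. *)
Lemma decimateK M (w : C) (p : {poly C}) : (0 < M)%N -> M.-primitive_root w ->
  p \Po (w *: 'X) = p -> decimate M p \Po 'X^M = p.
Proof.
move=> M0 wM pw; apply/polyP => j; rewrite coef_comp_poly_Xn //.
case: ifPn => [Mj|Mj].
  rewrite coef_poly divnK //; case: ltnP => // pj.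
  by rewrite nth_default // (leq_trans pj) // leq_div.
have : p`_j * w ^+ j = p`_j by rewrite -coef_comp_scale pw.
rewrite -[X in _ = X]mulr1 => /eqP; rewrite -subr_eq0 -mulrBr mulf_eq0 subr_eq0.
by rewrite -(prim_order_dvd wM) (negPf Mj) orbF => /eqP.
Qed.

Definition poly_at (A : comAlgType C) (u : A) : {rmorphism {poly C} -> A} := horner_alg u.

Lemma poly_atX (A : comAlgType C) (u : A) : poly_at u 'X = u.
Proof. exact: horner_algX. Qed.

Lemma poly_atC (A : comAlgType C) (u : A) c : poly_at u c%:P = c%:A.
Proof. exact: horner_algC. Qed.

Lemma poly_atZ (A : comAlgType C) (u : A) c p : poly_at u (c *: p) = c *: poly_at u p.
Proof. by rewrite -mul_polyC rmorphM poly_atC mulr_algl. Qed.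

Lemma poly_at_comp (A : comAlgType C) (u : A) p q :
  poly_at u (p \Po q) = poly_at (poly_at u q) p.
Proof.
elim/poly_ind: p => [|p c IH]; first by rewrite comp_poly0 !rmorph0.
rewrite comp_poly_MXaddC !rmorphD !rmorphM IH !poly_atC.
by congr (_ * _ + _); rewrite poly_atX.
Qed.

(* The norm of X^N - F(S) from C(S)[X] to C(S^M)[X]. *)
Definition norm_poly M N (F : {poly C}) : {poly {poly C}} :=
  \prod_(i < M) ('X^N - (F \Po (zeta R M ^+ i *: 'X))%:P).

(** The norm written in the variable T = S^M; this loses nothing because its coefficients are
    invariant under S |-> zeta_M S. *)
Definition descended M N F : {poly {poly C}} :=
  \poly_(k < size (norm_poly M N F)) decimate M (norm_poly M N F)`_k.

Lemma coef_descended M N F k : (descended M N F)`_k = decimate M (norm_poly M N F)`_k.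
Proof.
rewrite coef_poly; case: ltnP => // Nk.
by rewrite [in RHS]nth_default // /decimate size_poly0 poly_def big_ord0.
Qed.

Lemma prod_cyclic (A : comPzRingType) (G : nat -> A) M : G M = G 0%N ->
  \prod_(i < M) G i.+1 = \prod_(i < M) G i.
Proof.
case: M => [|M] GM; first by rewrite !big_ord0.
by rewrite big_ord_recr [in RHS]big_ord_recl mulrC GM.
Qed.

(** The substitution permutes the factors cyclically, as zeta_M^M = 1. *)
Lemma norm_poly_invariant M N F k : (0 < M)%N ->
  (norm_poly M N F)`_k \Po (zeta R M *: 'X) = (norm_poly M N F)`_k.
Proof.
move=> M0; set w := zeta R M.
pose sub : {rmorphism {poly C} -> {poly C}} := comp_poly (w *: 'X).
rewrite -[LHS]/(sub _) -(coef_map sub).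
suff -> : map_poly sub (norm_poly M N F) = norm_poly M N F by [].
rewrite /norm_poly rmorph_prod; pose G i : {poly {poly C}} := 'X^N - (F \Po (w ^+ i *: 'X))%:P.
have GS i : map_poly sub (G i) = G i.+1.
  rewrite /G rmorphB rmorphXn /= map_polyX map_polyC /=.
  congr (_ - _%:P); rewrite -[LHS]/(_ \Po _) -comp_polyA comp_polyZ comp_polyX.
  by rewrite scalerA -exprSr.
rewrite [LHS](eq_bigr (fun i : 'I_M => G i.+1)); last by move=> i _; exact: GS.
apply: prod_cyclic; rewrite /G (prim_expr_order (zeta_prim _ M0)) expr0 //.
Qed.

Lemma norm_poly_monic M N F : (0 < N)%N -> norm_poly M N F \is monic.
Proof. by move=> N0; apply: monic_prod => i _; exact: monicXnsubC. Qed.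

Lemma descended_monic M N F : (0 < N)%N -> descended M N F \is monic.
Proof.
move=> N0; have /monicP := norm_poly_monic M F N0; rewrite lead_coefE => lc.
have s0 : (0 < size (norm_poly M N F))%N.
  by rewrite size_poly_gt0 monic_neq0 // norm_poly_monic.
have dec1 : decimate M 1 = 1.
  by apply/polyP => j; rewrite coef_poly size_poly1 !coef1; case: j.
apply/monicP; rewrite /descended -(prednK s0) lead_coef_poly ?lc ?dec1 ?oner_neq0 //.
Qed.

Section OverAlgebra.
Variables (A : comAlgType C) (u : A) (M N : nat) (F : {poly C}).
Hypotheses (M0 : (0 < M)%N) (N0 : (0 < N)%N).

(** Any M-th root [u] of the evaluation point is allowed: T^(1/l^m) serves to show that the norm
    vanishes at f, and a power series root of a + T to split it near a. *)
Lemma map_descended : map_poly (poly_at (u ^+ M)) (descended M N F) =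
  \prod_(i < M) ('X^N - (poly_at (zeta R M ^+ i *: u) F)%:P).
Proof.
transitivity (map_poly (poly_at u) (norm_poly M N F)).
  apply/polyP => k; rewrite !coef_map coef_descended.
  rewrite -[in RHS](decimateK M0 (zeta_prim R M0) (norm_poly_invariant N F k M0)).
  have /= -> := poly_at_comp u (decimate M (norm_poly M N F)`_k) 'X^M.
  by rewrite rmorphXn poly_atX.
rewrite rmorph_prod; apply: eq_bigr => i _.
rewrite rmorphB rmorphXn /= map_polyX map_polyC /=.
by rewrite [poly_at u _]poly_at_comp poly_atZ poly_atX.
Qed.

Lemma XnsubC_split (g : A) :
  'X^N - (g ^+ N)%:P = \prod_(t < N) ('X - (zeta R N ^+ t *: g)%:P) :> {poly A}.
Proof.
pose h : {rmorphism C -> {poly A}} := polyC \o in_alg A.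
rewrite rmorphXn -(prod_sub_zeta h 'X g%:P N0); apply: eq_bigr => i _.
by rewrite /= -rmorphM mulr_algl.
Qed.
End OverAlgebra.
End Descent.

(** * Roots of power series with nonzero constant term *)

Section PowerSeries.
Variable R : realType.
Local Notation C := R[i].
Local Notation Omega := (puiseux C).
Implicit Types (u v g : Omega).

Lemma grid10 k : grid 1 0 k = k%:R.
Proof. by rewrite /grid subr0 divr1. Qed.

Lemma pseriesP v : is_pseries v <-> gridded 1 0 (pcoef v).
Proof.
split=> hv q /hv; first by move=> /natrP[k ->]; exists k; rewrite grid10.
by move=> [k ->]; rewrite grid10 natr_nat.
Qed.

Lemma pseries_nonneg v : is_pseries v -> nonneg_supp v.
Proof. by move=> /pseriesP hv; exists 1%N. Qed.

Lemma pseriesM u v : is_pseries u -> is_pseries v -> is_pseries (u * v).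
Proof. by move=> /pseriesP hu /pseriesP hv; apply/pseriesP; exact: (gridded_conv hu hv). Qed.

Lemma pseriesD u v : is_pseries u -> is_pseries v -> is_pseries (u + v).
Proof.
move=> hu hv q /=; have [->|/hu//] := eqVneq (pcoef u q) 0; rewrite add0r; exact: hv.
Qed.

Lemma pseriesZ (c : C) u : is_pseries u -> is_pseries (c *: u).
Proof. by move=> hu q /=; rewrite mulf_eq0 negb_or => /andP[_ /hu]. Qed.

Lemma pseries1 : is_pseries (1 : Omega).
Proof. by move=> q /=; have [->|_] := eqVneq q 0; rewrite ?eqxx // rpred0. Qed.

Lemma pseries_poly_at u F : is_pseries u ->
  is_pseries (poly_at u F) /\ pcoef (poly_at u F) 0 = F.[pcoef u 0].
Proof.
move=> hu; elim/poly_ind: F => [|F c [IH1 IH2]].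
  by rewrite rmorph0 horner0; split=> // q /=; rewrite eqxx.
rewrite rmorphD rmorphM poly_atX poly_atC; split.
  by apply: pseriesD; [exact: pseriesM|apply: pseriesZ; exact: pseries1].
rewrite -[LHS]/(pcoef (poly_at u F * u) 0 + c * pcoef (1 : Omega) 0) pcoef01 mulr1.
by rewrite pcoef0M ?IH2 ?hornerMXaddC //; exact: pseries_nonneg.
Qed.

Lemma exprD_mod2 (A : comNzRingType) (p d : A) n : exists q,
  (p + d) ^+ n.+1 = p ^+ n.+1 + n.+1%:R * p ^+ n * d + d ^+ 2 * q.
Proof.
elim: n => [|n [q IH]]; first by exists 0; rewrite !expr1 expr0 mulr0 addr0 !mul1r.
exists (n.+1%:R * p ^+ n + (p + d) * q).
rewrite exprS IH -[n.+2%:R]natr1 !exprS; set P := p ^+ n; set k := n.+1%:R; ring.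
Qed.

Lemma coef_pow_pseries v (P : {poly C}) k n : is_pseries v ->
  (forall j, (j <= k)%N -> pcoef v j%:R = P`_j) ->
  forall j, (j <= k)%N -> pcoef (v ^+ n) j%:R = (P ^+ n)`_j.
Proof.
move=> hv vP; have hvn m : is_pseries (v ^+ m).
  by elim: m => [|m IH]; [exact: pseries1|rewrite exprS; exact: pseriesM].
elim: n => [|n IH] j jk; first by rewrite !expr0 coef1 /= pnatr_eq0.
rewrite !exprS coefM -(grid10 j) [LHS](conv_grid (B := 0) (D := 0)) //; last 2 first.
- exact/pseriesP.
- exact/pseriesP.
by apply: eq_bigr => -[i ij] _; rewrite !grid10 vP ?IH //=; lia.
Qed.

(* Coefficient by coefficient: the coefficient of T^(k+1) in (p + d T^(k+1))^n is that of
   p^n plus n p(0)^(n-1) d. *)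
Lemma pseries_root v n : (0 < n)%N -> is_pseries v -> pcoef v 0 != 0 ->
  exists2 g, is_pseries g & g ^+ n = v.
Proof.
move=> n0 hv v0; set t := n.-root (pcoef v 0).
have tn : t ^+ n = pcoef v 0 by rewrite rootCK.
have t0 : t != 0 by apply: contraNneq v0 => t0; rewrite -tn t0 expr0n gtn_eqF.
have nt0 : n%:R * t ^+ n.-1 != 0 by rewrite mulf_neq0 ?expf_neq0 // pnatr_eq0 -lt0n.
pose step k (p : {poly C}) : {poly C} := p +
  ((pcoef v k.+1%:R - (p ^+ n)`_k.+1) / (n%:R * t ^+ n.-1)) *: 'X^(k.+1).
pose p := fix p k : {poly C} := if k is k'.+1 then step k' (p k') else t%:P.
have pS k j : (j <= k)%N -> (p k.+1)`_j = (p k)`_j.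
  by move=> jk; rewrite /= coefD coefZ coefXn ltn_eqF ?mulr0 ?addr0 // ltnS.
have pE k j : (j <= k)%N -> (p k)`_j = (p j)`_j.
  by move=> /subnKC <-; elim: (k - j)%N => [|i IH]; rewrite ?addn0 // addnS pS ?leq_addr.
have p0 k : (p k)`_0 = t by rewrite pE //= coefC.
have pn k j : (j <= k)%N -> ((p k) ^+ n)`_j = pcoef v j%:R.
  elim: k j => [|k IH] j; first by rewrite leqn0 => /eqP ->; rewrite /= -rmorphXn coefC /= tn.
  rewrite -[p k.+1]/(step k (p k)) /step; set d := _ / _.
  have [q] := exprD_mod2 (p k) (d *: 'X^(k.+1)) n.-1; rewrite prednK // => -> jk.
  have D0 : ((d *: 'X^(k.+1)) ^+ 2 * q)`_j = 0.
    by rewrite exprZn -exprM -scalerAl coefZ [_ * q]mulrC coefMXn ifT ?mulr0 //; lia.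
  rewrite 2!coefD D0 addr0 -scalerAr coefZ coefMXn.
  move: jk; rewrite leq_eqVlt => /orP[/eqP ->|]; last first.
    by rewrite ltnS => jk; rewrite jk mulr0 addr0 IH.
  rewrite ltnn subnn -[n%:R]polyC_natr coefCM -horner_coef0 horner_exp horner_coef0 p0.
  rewrite /d (divfK nt0) addrC; exact: subrK.
pose f (q : rat) := if q \is a Num.nat then (p (Num.truncn q))`_(Num.truncn q) else 0.
have fP : exists N B, (0 < N)%N /\ gridded N B f.
  exists 1%N, 0%N; split=> // q; rewrite /f; case: natrP => [[k ->] _|]; last by rewrite eqxx.
  by exists k; rewrite grid10.
have hg : is_pseries (Puiseux fP).
  by move=> q /=; rewrite /f; case: ifP => //; rewrite eqxx.
have gE k j : (j <= k)%N -> pcoef (Puiseux fP) j%:R = (p k)`_j.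
  by move=> jk; rewrite /= /f natr_nat natrK pE.
exists (Puiseux fP) => //; apply: puiseuxP.
have hgn : is_pseries (Puiseux fP ^+ n).
  elim: (n) => [|m IH]; [exact: pseries1|rewrite exprS; exact: pseriesM].
apply: (@gridded_eq _ 1 0); [exact/pseriesP|exact/pseriesP|].
by move=> k; rewrite grid10 (coef_pow_pseries n hg (gE k)) ?pn.
Qed.
End PowerSeries.

(** * The universal pro-l cover *)

Section UniversalCover.
Variables (R : realType) (K : divringClosed R[i]) (l : nat) (hl : prime l).
Variables (n : nat) (hn : (0 < n)%N).
Local Notation C := R[i].
Local Notation Omega := (puiseux C).
Local Notation Kbar := (Kbar K).
Implicit Types (f g u : Omega) (F G : {poly C}).

Lemma lgt0 m : (0 < l ^ m)%N.
Proof. exact: expl_gt0. Qed.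

Lemma in_prol_sum (I : Type) (s : seq I) (f : I -> Omega) :
  (forall i, in_prol K l (f i)) -> in_prol K l (\sum_(i <- s) f i).
Proof.
move=> hf; elim: s => [|i s IH]; last by rewrite big_cons; exact: prol_add.
by rewrite big_nil -(scale0r 1); apply: prol_const; apply: KbarK; exact: rpred0.
Qed.

Lemma in_prolX f k : in_prol K l f -> in_prol K l (f ^+ k).
Proof.
move=> hf; elim: k => [|k IH]; last by rewrite exprS; exact: prol_mul.
by rewrite expr0 -(scale1r 1); apply: prol_const; exact: Kbar1.
Qed.

Lemma in_prol_root r f : in_prol K l (f ^+ (l ^ r)) -> in_prol K l f.
Proof.
elim: r f => [|r IH] f; first by rewrite expr1.
by rewrite expnS exprM => /IH hf; exact: prol_root hf erefl.
Qed.

Lemma in_prol_Troot m : in_prol K l (Troot R l m).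
Proof.
apply: (@in_prol_root m); rewrite TpowX divff; first exact: prol_T.
by rewrite pnatr_eq0 -lt0n lgt0.
Qed.

Lemma in_prol_poly_at u F : in_prol K l u -> (forall i, Kbar F`_i) ->
  in_prol K l (poly_at u F).
Proof.
move=> hu hF; rewrite -[F]coefK poly_def rmorph_sum; apply: in_prol_sum => i.
rewrite poly_atZ rmorphXn poly_atX -mulr_algl.
by apply: prol_mul; [apply: prol_const; exact: hF|exact: in_prolX].
Qed.

(** A root b is a value of T^(1/l^m), so the second condition says that the value b^(l^m) of T lies
    in {0} or mu_n. *)
Definition cover_poly m F := (forall i, Kbar F`_i) /\
  (forall b, root F b -> b = 0 \/ b ^+ (n * l ^ m) = 1).

(* The elements of the universal pro-l cover that are needed: the l^r-th roots of
   polynomials in T^(1/l^m) vanishing only over 0 and mu_n. *)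
Definition cover_elt m r f := exists2 F, cover_poly m F &
  f ^+ (l ^ r) = poly_at (Troot R l m) F.

Lemma Troot_pow m : Troot R l m ^+ (l ^ m) = Tpow C 1.
Proof. by rewrite TpowX divff // pnatr_eq0 -lt0n lgt0. Qed.

Lemma Kbar_descended M N F i j : (0 < M)%N -> (forall i, Kbar F`_i) ->
  Kbar (descended M N F)`_i`_j.
Proof.
move=> M0 hF; rewrite coef_descended coef_poly; case: ifP => _; last first.
  by apply: KbarK; exact: rpred0.
have FK k : F \Po (zeta R M ^+ k *: 'X) \is a polyOver (Kbar_pred K).
  apply/polyOverP => t; rewrite coef_comp_scale; apply/asboolP.
  apply: KbarM => //; do 2 apply: KbarX.
  by apply: (Kbar_unity _ M0); exact: prim_expr_order (zeta_prim _ M0).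
have : norm_poly M N F \is a polyOver (polyOver_pred (Kbar_pred K)).
  rewrite /norm_poly; apply: rpred_prod => k _; apply: rpredB; first exact: polyOverXn.
  by rewrite polyOverC; exact: FK.
by move=> /polyOverP/(_ i)/polyOverP/(_ (j * M)%N)/asboolP.
Qed.

(** The series is a^(1/M) (1 + T/a)^(1/M), expanded by the binomial formula. *)
Lemma root_shift (a : C) M : (0 < M)%N -> a != 0 -> exists u,
  [/\ is_pseries u, u ^+ M = a%:A + Tpow C 1 & pcoef u 0 ^+ M = a].
Proof.
move=> M0 a0; exists (M.-root a *: binser 1 M%:R^-1 a^-1); split.
- apply: pseriesZ => q /binser_ray[]// i ->; rewrite mulr1; exact: natr_nat.
- by rewrite exprZn rootCK // binser_root // scalerDr scalerA mulfV // scale1r.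
- rewrite -[pcoef _ 0]/(_ * pcoef (binser 1 M%:R^-1 a^-1) 0) pcoef0_binser // mulr1.
  by rewrite rootCK.
Qed.

(** With u^M = a + T, the series F(zeta_M^i u) has constant term F(b) with b^M = a. As a is neither
    0 nor in mu_n, b is not a root of F, so an l^r-th root exists among power series; its multiples
    by powers of zeta_N are the others. *)
Lemma cover_elt_split m r F a : cover_poly m F -> a != 0 -> a ^+ n != 1 ->
  exists rs : seq Omega, (forall g, g \in rs -> is_pseries g) /\
    map_poly (poly_at (a%:A + Tpow C 1)) (descended (l ^ m) (l ^ r) F) =
    \prod_(g <- rs) ('X - g%:P).
Proof.
move=> [_ hF] a0 an; set M := (l ^ m)%N; set N := (l ^ r)%N.
have [u [hu uM u0]] := root_shift (lgt0 m) a0.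
pose v i := poly_at (zeta R M ^+ i *: u) F.
have hv i : exists2 g, is_pseries g & g ^+ N = v i.
  have hwu : is_pseries (zeta R M ^+ i *: u) by exact: pseriesZ.
  have [hvi v0] := pseries_poly_at F hwu; apply: pseries_root => //; first exact: lgt0.
  rewrite v0; apply/negP => /hF; rewrite -[pcoef _ _]/(zeta R M ^+ i * pcoef u 0).
  have powM : (zeta R M ^+ i * pcoef u 0) ^+ M = a.
    by rewrite exprMn u0 exprAC (prim_expr_order (zeta_prim _ (lgt0 m))) expr1n mul1r.
  case=> [b0|]; last by rewrite mulnC exprM powM => /eqP; rewrite (negPf an).
  by move: powM a0; rewrite b0 expr0n gtn_eqF ?lgt0 // => <-; rewrite eqxx.
have /boolp.choice[g hg] : forall i, exists g, is_pseries g /\ g ^+ N = v i.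
  by move=> i; have [g] := hv i; exists g.
exists [seq zeta R N ^+ t *: g i | i <- index_iota 0 M, t <- index_iota 0 N]; split.
  by move=> _ /allpairsP[[i t] [_ _ ->]]; apply: pseriesZ; case: (hg i).
rewrite big_allpairs_dep -uM map_descended ?lgt0 // big_mkord.
apply: eq_bigr => i _; rewrite -/(v i) -(proj2 (hg i)) XnsubC_split ?lgt0 //.
by rewrite big_mkord.
Qed.

(** The polynomial required by [unramified_integral] is [descended]. It is monic, so its leading
    coefficient has no roots. *)
Lemma cover_elt_univ m r f : cover_elt m r f -> univ_ring K l n f.
Proof.
move=> [F FF fF]; split.
  apply: (@in_prol_root r); rewrite fF; apply: in_prol_poly_at; last exact: FF.1.
  exact: in_prol_Troot.
exists (descended (l ^ m) (l ^ r) F); split.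
- by move=> i j; apply: Kbar_descended; [exact: lgt0|exact: FF.1].
- have /monicP -> := descended_monic (l ^ m) F (lgt0 r) => a.
  by rewrite (negPf (root1 a)).
- rewrite /evalT -(Troot_pow m) -[map_poly _ _]/(map_poly (poly_at _) _).
  rewrite map_descended ?lgt0 // rootE horner_prod.
  (* The factor i = 0 of the norm is X^(l^r) - f^(l^r), which vanishes at f. *)
  rewrite (bigD1 (Ordinal (lgt0 m))) //= expr0 scale1r -fF !hornerE subrr.
  by rewrite mul0r.
- move=> a _ a0 an; have [rs [hrs split_rs]] := cover_elt_split r FF a0 an.
  by exists 1, rs; split=> //; rewrite scale1r -split_rs.
Qed.

Lemma cover_eltM m r f g : cover_elt m r f -> cover_elt m r g -> cover_elt m r (f * g).
Proof.
move=> [F [FK Froot] fF] [G [GK Groot] gG]; exists (F * G); last first.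
  by rewrite exprMn fF gG rmorphM.
split=> [i|b]; last by rewrite rootM => /orP[/Froot|/Groot].
have : F * G \is a polyOver (Kbar_pred K).
  by apply: rpredM; apply/polyOverP => j; apply/asboolP.
by move=> /polyOverP/(_ i)/asboolP.
Qed.

Lemma cover_elt_const m c : Kbar c -> c != 0 -> cover_elt m 0 c%:A.
Proof.
move=> hc c0; exists c%:P; last by rewrite poly_atC expr1.
split=> [i|b]; last by rewrite rootC (negPf c0).
by rewrite coefC; case: ifP => // _; apply: KbarK; exact: rpred0.
Qed.

Lemma cover_elt1 m r : cover_elt m r 1.
Proof.
exists 1; last by rewrite expr1n rmorph1.
split=> [i|b]; last by rewrite (negPf (root1 b)).
by rewrite coef1; case: eqP => _; [exact: Kbar1|apply: KbarK; exact: rpred0].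
Qed.

Lemma cover_eltX m r f k : cover_elt m r f -> cover_elt m r (f ^+ k).
Proof.
by move=> hf; elim: k => [|k IH]; [exact: cover_elt1|rewrite exprS; exact: cover_eltM].
Qed.

Lemma cover_elt_Troot m : cover_elt m 0 (Troot R l m).
Proof.
exists 'X; last by rewrite poly_atX expr1.
split=> [i|b]; last by rewrite rootX => /eqP ->; left.
by rewrite coefX; case: eqP => _; [exact: Kbar1|apply: KbarK; exact: rpred0].
Qed.

Lemma Tpow_div d m : Tpow C (d%:R / (l ^ m)%:R) = Troot R l m ^+ d.
Proof. by rewrite TpowX. Qed.

(** The path pi_n(gamma) needs d = n, the rotated paths d = 1. The order l^r of the root is
    independent of m, because the l-distribution relation compares an l^m-th root with functions of
    T^(1/l^(m+1)). *)
Definition one_sub_pow d m r (c : C) : Omega :=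
  binser (d%:R / (l ^ m)%:R) (l ^ r)%:R^-1 (- c).

Lemma one_sub_pow_exp d m r c : (0 < d)%N ->
  one_sub_pow d m r c ^+ (l ^ r) = 1 - c *: Troot R l m ^+ d.
Proof.
move=> d0; rewrite binser_root ?lgt0 ?divr_gt0 ?ltr0n ?lgt0 //.
by rewrite Tpow_div scaleNr.
Qed.

(** A root b of 1 - c X^d satisfies c b^d = 1, whence b^(n l^m) = (c b^d)^(k l^m) = 1. *)
Lemma cover_elt_one_sub_pow d k m r c : (d * k = n)%N -> c ^+ (k * l ^ m) = 1 ->
  cover_elt m r (one_sub_pow d m r c).
Proof.
move=> dk ck; have [d0 k0] : (0 < d)%N /\ (0 < k)%N.
  by move: hn; rewrite -dk muln_gt0 => /andP.
exists (1 - c *: 'X^d); last first.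
  by rewrite one_sub_pow_exp // rmorphB rmorph1 poly_atZ rmorphXn poly_atX.
have kl0 : (0 < k * l ^ m)%N by rewrite muln_gt0 k0 lgt0.
split=> [i|b].
  rewrite coefB coef1 coefZ coefXn; apply: KbarB.
    by case: eqP => _; [exact: Kbar1|apply: KbarK; exact: rpred0].
  case: eqP => _; last by rewrite mulr0; apply: KbarK; exact: rpred0.
  by rewrite mulr1; exact: (Kbar_unity _ kl0 ck).
rewrite rootE !hornerE subr_eq0 => /eqP cb; right.
rewrite -dk -mulnA exprM -[LHS]mul1r -{1}ck -exprMn -cb expr1n //.
Qed.

Lemma prod_one_sub_pow d m r c N : (0 < d)%N -> (0 < N)%N ->
  \prod_(j < N) one_sub_pow d m r (zeta R N ^+ j * c) =
  binser (N%:R * (d%:R / (l ^ m)%:R)) (l ^ r)%:R^-1 (- c ^+ N).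
Proof. by move=> d0 N0; apply: prod_binser; rewrite ?lgt0 // divr_gt0 ?ltr0n ?lgt0. Qed.

Lemma one_sub_powS d m r c : (0 < d)%N ->
  one_sub_pow d m r.+1 c ^+ l = one_sub_pow d m r c.
Proof.
move=> d0; rewrite binserX ?divr_gt0 ?ltr0n ?lgt0 //; congr binser.
by rewrite expnS natrM invfM mulVKf // pnatr_eq0 -lt0n prime_gt0.
Qed.

Section Path.
Variables (z : C) (gamma : Omega -> C) (hgamma : is_path K l n z gamma).

Lemma path1 : gamma 1 = 1.
Proof. by case: hgamma => _ gc _ _; rewrite -[1 in LHS]scale1r gc //; exact: Kbar1. Qed.

Lemma pathM m r f g : cover_elt m r f -> cover_elt m r g ->
  gamma (f * g) = gamma f * gamma g.
Proof.
by case: hgamma => _ _ _ gM /cover_elt_univ hf /cover_elt_univ hg; exact: gM.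
Qed.

Lemma pathX m r f k : cover_elt m r f -> gamma (f ^+ k) = gamma f ^+ k.
Proof.
move=> hf; elim: k => [|k IH]; first by rewrite !expr0 path1.
by rewrite !exprS (pathM hf (cover_eltX k hf)) IH.
Qed.

Lemma path_prod m r (I : Type) (s : seq I) (f : I -> Omega) :
  (forall i, cover_elt m r (f i)) ->
  gamma (\prod_(i <- s) f i) = \prod_(i <- s) gamma (f i).
Proof.
move=> hf; elim: s => [|i s IH]; first by rewrite !big_nil path1.
have hs : cover_elt m r (\prod_(i <- s) f i).
  by elim/big_ind: _ => //; [exact: cover_elt1|exact: cover_eltM].
by rewrite !big_cons (pathM (hf i) hs) IH.
Qed.

Lemma path_scale m c f : Kbar c -> c != 0 -> cover_elt m 0 f ->
  gamma (c *: f) = c * gamma f.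
Proof.
move=> hc c0 hf; rewrite -mulr_algl (pathM (cover_elt_const m hc c0) hf).
by case: hgamma => _ -> .
Qed.

Lemma path_Troot m : gamma (Troot R l m) ^+ (l ^ m) = z.
Proof.
by rewrite -(pathX _ (cover_elt_Troot m)) Troot_pow; case: hgamma.
Qed.

Lemma path_TrootS m : gamma (Troot R l m.+1) ^+ l = gamma (Troot R l m).
Proof.
rewrite -(pathX _ (cover_elt_Troot m.+1)) TpowX; congr (gamma (Tpow _ _)).
by rewrite expnS natrM invfM mulVKf // pnatr_eq0 -lt0n prime_gt0.
Qed.

(** Additivity of gamma enters here, in evaluating 1 - c T^(d/l^m); the other relations between
    values of gamma come from products. *)
Lemma path_one_sub_pow d k m r c : (d * k = n)%N -> c ^+ (k * l ^ m) = 1 ->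
  gamma (one_sub_pow d m r c) ^+ (l ^ r) = 1 - c * gamma (Troot R l m) ^+ d.
Proof.
move=> dk ck; have [d0 k0] : (0 < d)%N /\ (0 < k)%N.
  by move: hn; rewrite -dk muln_gt0 => /andP.
have kl0 : (0 < k * l ^ m)%N by rewrite muln_gt0 k0 lgt0.
have c0 : c != 0.
  apply/eqP => c0; move: ck; rewrite c0 expr0n gtn_eqF //= => /eqP.
  by rewrite eq_sym oner_eq0.
have hT := cover_eltX d (cover_elt_Troot m).
rewrite -(pathX _ (cover_elt_one_sub_pow r dk ck)) one_sub_pow_exp //.
have hc : Kbar (- c).
  by rewrite -sub0r; apply: KbarB; [apply: KbarK; exact: rpred0|exact: (Kbar_unity K kl0 ck)].
rewrite -scaleNr; have [_ _ gD _] := hgamma; rewrite gD.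
- by rewrite path1 (path_scale hc _ hT) ?oppr_eq0 // (pathX _ (cover_elt_Troot m)) mulNr.
- exact: (cover_elt_univ (cover_elt1 0 0)).
- rewrite -mulr_algl; apply: (cover_elt_univ (m := m) (r := 0)).
  by apply: cover_eltM hT; apply: cover_elt_const => //; rewrite oppr_eq0.
Qed.
End Path.
End UniversalCover.

(** * Polylogarithmic characters *)

Section BigOrdMul.
Variables (A : Type) (idx : A) (op : Monoid.com_law idx).

Lemma big_ord_mul n q (P : nat -> bool) (G : nat -> A) :
  \big[op/idx]_(j < n * q | P j) G j =
  \big[op/idx]_(a < q) \big[op/idx]_(s < n | P (n * a + s)%N) G (n * a + s)%N.
Proof.
elim: q => [|q IH]; first by rewrite muln0 !big_ord0.
rewrite big_ord_recr -IH mulnS addnC big_mkcond big_split_ord /=.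
by congr (op _ _); rewrite [RHS]big_mkcond.
Qed.

Lemma big_ord_residue q k x (G : nat -> A) : (x < q)%N ->
  \big[op/idx]_(b < q * k | (b %% q == x)%N) G b = \big[op/idx]_(j < k) G (x + j * q)%N.
Proof.
move=> xq; rewrite (big_ord_mul q k (fun b => b %% q == x)%N); apply: eq_bigr => a _.
rewrite (big_pred1 (Ordinal xq)) => [|i] /=; first by rewrite addnC mulnC.
by rewrite mulnC modnMDl modn_small.
Qed.
End BigOrdMul.

Section Galois.
Variables (R : realType) (l : nat) (hl : prime l) (K : divringClosed R[i]).
Variables (sigma : R[i] -> R[i]) (hsigma : in_Gal K sigma).
Local Notation C := R[i].
Local Notation Omega := (puiseux C).
Local Notation Kbar := (Kbar K).
Local Notation Zl := (padicint hl).
Local Notation zetapow := (@zetapow R l hl).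
Local Notation chi := (cyclo hl sigma).

Lemma gal_fix x : x \in K -> sigma x = x.
Proof. by case: hsigma => _ h _ _; exact: h. Qed.

Lemma gal1 : sigma 1 = 1.
Proof. by apply: gal_fix; exact: rpred1. Qed.

Lemma galM x y : Kbar x -> Kbar y -> sigma (x * y) = sigma x * sigma y.
Proof. by case: hsigma => _ _ _ h; exact: h. Qed.

Lemma galX x k : Kbar x -> sigma (x ^+ k) = sigma x ^+ k.
Proof.
move=> hx; elim: k => [|k IH]; first exact: gal1.
by rewrite !exprS galM ?IH //; exact: KbarX.
Qed.

Lemma gal_one_sub x : Kbar x -> sigma (1 - x) = 1 - sigma x.
Proof.
move=> hx; have h1x := KbarB (Kbar1 K) hx.
case: hsigma => _ _ hD _; apply/eqP; rewrite eq_sym subr_eq -hD //.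
by rewrite subrK gal1.
Qed.

Lemma Kbar_prod (I : Type) (s : seq I) (P : pred I) (f : I -> C) :
  (forall i, Kbar (f i)) -> Kbar (\prod_(i <- s | P i) f i).
Proof. by move=> hf; elim/big_ind: _ => //; [exact: Kbar1|exact: KbarM]. Qed.

Lemma gal_prod (I : Type) (s : seq I) (P : pred I) (f : I -> C) :
  (forall i, Kbar (f i)) ->
  sigma (\prod_(i <- s | P i) f i) = \prod_(i <- s | P i) sigma (f i).
Proof.
move=> hf; elim: s => [|i s IH]; first by rewrite !big_nil gal1.
rewrite !big_cons; case: (P i) => //; rewrite galM ?IH //; exact: Kbar_prod.
Qed.

Lemma gal_inj x y : Kbar x -> Kbar y -> sigma x = sigma y -> x = y.
Proof.
case: hsigma => -[_ inj _] _ _ _ hx hy; apply: inj; exact/mem_set.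
Qed.

Lemma gal_surj y : Kbar y -> exists2 x, Kbar x & sigma x = y.
Proof. by case: hsigma => -[_ _ surj] _ _ _ /surj[x hx <-]; exists x. Qed.

Lemma Kbar_zeta N k : (0 < N)%N -> Kbar (zeta R N ^+ k).
Proof.
move=> N0; apply: KbarX; apply: (Kbar_unity _ N0).
exact: prim_expr_order (zeta_prim _ N0).
Qed.

Lemma Kbar_zetapow m x : Kbar (zetapow m x).
Proof. exact/Kbar_zeta/expl_gt0. Qed.

Lemma zetaS m : zeta R (l ^ m.+1) ^+ l = zeta R (l ^ m).
Proof.
by have := zetaXM R (l ^ m) 1 (prime_gt0 hl); rewrite -(expnSr l m) mul1n expr1.
Qed.

Lemma zetapow1 m : zetapow m 1 = zeta R (l ^ m).
Proof. by rewrite -[RHS]expr1 -(zetapow_nat hl R). Qed.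

Lemma cyclo_zeta m : sigma (zeta R (l ^ m)) = zetapow m chi.
Proof.
have hz k : Kbar (zeta R (l ^ k)) by rewrite -[zeta _ _]expr1; exact/Kbar_zeta/expl_gt0.
suff [x hx] : exists x : Zl, forall m, sigma (zeta R (l ^ m)) = zetapow m x.
  exact: (xgetPex (P := [set x : Zl | forall m, sigma (zeta R (l ^ m)) = zetapow m x]) 1
    (ex_intro _ x hx) m).
apply: tate_module => k; rewrite -galX //.
  by rewrite (prim_expr_order (zetapow_primroot hl R k)) gal1.
by rewrite zetaS.
Qed.

Lemma gal_zetapow m x : sigma (zetapow m x) = zetapow m (chi * x).
Proof.
rewrite zetapowM -cyclo_zeta zetapow_res galX // -[zeta _ _]expr1.
exact/Kbar_zeta/expl_gt0.
Qed.

(* The inverse of chi is the cyclotomic character of the inverse of sigma. *)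
Lemma cyclo_unit : chi \is a GRing.unit.
Proof.
have hz k : Kbar (zeta R (l ^ k)) by rewrite -[zeta _ _]expr1; exact/Kbar_zeta/expl_gt0.
have /boolp.choice[e he] m : exists e, Kbar e /\ sigma e = zeta R (l ^ m).
  by have [e] := gal_surj (hz m); exists e.
have [x hx] : exists x : Zl, forall m, e m = zetapow m x.
  apply: tate_module => m; have [hem sem] := he m.
    apply: gal_inj; rewrite ?galX ?sem ?gal1 //; [exact: KbarX|exact: Kbar1|].
    by rewrite (prim_expr_order (zetapow_primroot hl R m)).
  have [hem' sem'] := he m.+1.
  by apply: gal_inj => //; [exact: KbarX|rewrite galX // sem' sem zetaS].
apply/unitrP; exists x; rewrite [x * _]mulrC; split;
  apply: (@zetapow_inj _ _ R) => m; rewrite -gal_zetapow -hx (he m).2;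
  by rewrite zetapow1.
Qed.

Section KHPath.
Variable g : Omega -> C.

(* What the construction of the polylogarithmic characters uses of a path on V_1. *)
Record kh_path : Prop := KHPath {
  kh_root : forall m, g (Troot R l m.+1) ^+ l = g (Troot R l m);
  kh_end : [/\ g (Troot R l 0) \in K, g (Troot R l 0) != 0 & g (Troot R l 0) != 1];
  kh_exp : forall m (x : Zl),
    g (one_sub_root R m x) ^+ (l ^ m) = 1 - zetapow m x * g (Troot R l m);
  kh_dist : forall m (x : Zl),
    \prod_(b < l ^ m.+1 | (res (b%:R : Zl) m == res x m))
      g (one_sub_root R m.+1 (b%:R : Zl)) ^+ l = g (one_sub_root R m x) }.

Hypothesis hg : kh_path.
Local Notation w m := (g (Troot R l m)).
Local Notation Y m x := (g (one_sub_root R m (x : Zl))).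
Local Notation rho := (kummer hl g sigma).

Lemma one_sub_root_res m (x y : Zl) : res x m = res y m ->
  one_sub_root R m x = one_sub_root R m y.
Proof. by move=> xy; rewrite /one_sub_root /Defs.zetapow xy. Qed.

Lemma kh_root_pow m : w m ^+ (l ^ m) = w 0.
Proof.
elim: m => [|m IH]; first by rewrite expn0 expr1.
by rewrite expnS exprM kh_root.
Qed.

Lemma kh_Kbar_root m : Kbar (w m).
Proof.
apply: (@Kbar_root _ _ _ (l ^ m)); first exact: expl_gt0.
by rewrite kh_root_pow; apply: KbarK; case: (kh_end hg).
Qed.

Lemma kh_root_neq0 m : w m != 0.
Proof.
have [_ w0 _] := kh_end hg; apply: contraNneq w0 => wm0.
by rewrite -(kh_root_pow m) wm0 expr0n gtn_eqF // expl_gt0.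
Qed.

Lemma kh_one_sub_neq0 m x : 1 - zetapow m x * w m != 0.
Proof.
have [_ _ w1] := kh_end hg; rewrite subr_eq0; apply: contraNneq w1 => e; apply/eqP.
have := congr1 (fun t => t ^+ (l ^ m)) e.
by rewrite expr1n exprMn zetapow_order mul1r kh_root_pow => ->.
Qed.

Lemma kh_Kbar m x : Kbar (Y m x).
Proof.
apply: (@Kbar_root _ _ _ (l ^ m)); first exact: expl_gt0.
rewrite kh_exp //; apply: KbarB; first exact: Kbar1.
by apply: KbarM; [exact: Kbar_zetapow|exact: kh_Kbar_root].
Qed.

Lemma kummer_root m : sigma (w m) = zetapow m rho * w m.
Proof.
suff [x hx] : exists x : Zl, forall m, sigma (w m) = zetapow m x * w m.
  exact: (xgetPex (P := [set x : Zl | forall m, sigma (w m) = zetapow m x * w m]) 0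
    (ex_intro _ x hx) m).
have [x hx] : exists x : Zl, forall m, sigma (w m) / w m = zetapow m x.
  apply: tate_module => k.
    rewrite exprMn exprVn -galX ?kh_root_pow ?gal_fix ?divff //; last exact: kh_Kbar_root.
      by case: (kh_end hg).
    by case: (kh_end hg).
  by rewrite exprMn exprVn -galX ?(kh_root hg) //; exact: kh_Kbar_root.
by exists x => k; rewrite -hx divfK // kh_root_neq0.
Qed.

(* The value mod l^m of the Kummer-Heisenberg measure on x + l^m Z_l, as a root of 1. *)
Definition kh_value m (x : Zl) : C := sigma (Y m (chi^-1 * x)) / Y m (x + rho).

(** sigma maps 1 - zeta^(x/chi) w^(1/l^m) to 1 - zeta^(x + rho) w^(1/l^m), so numerator and
    denominator are l^m-th roots of the same number. *)
Lemma kh_value_order m x : kh_value m x ^+ (l ^ m) = 1.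
Proof.
rewrite exprMn exprVn -galX ?kh_exp //; last exact: kh_Kbar.
have hz := Kbar_zetapow m; have hw := kh_Kbar_root m.
rewrite gal_one_sub; last exact: KbarM.
rewrite galM // gal_zetapow kummer_root mulrA -zetapowD mulrA mulrV ?cyclo_unit // mul1r.
by rewrite divff // kh_one_sub_neq0.
Qed.

Lemma res_eq_mul (u x y : Zl) m : u \is a GRing.unit ->
  ((res (u * x : Zl) m == res (u * y : Zl) m) = (res x m == res y m)).
Proof.
move=> uU; apply/eqP/eqP => xy; last exact: eq_resM.
by rewrite -[x](mulKr uU) -[y](mulKr uU); exact: eq_resM.
Qed.

Lemma res_eq_add (v x y : Zl) m :
  ((res (x + v : Zl) m == res (y + v : Zl) m) = (res x m == res y m)).
Proof.
apply/eqP/eqP => xy; last exact: eq_resD.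
by rewrite -[x](addrK v) -[y](addrK v); exact: eq_resD.
Qed.

(** This is additivity of the measure on x + l^m Z_l, cut into l classes modulo l^(m+1). The l-th
    power turns values modulo l^(m+1) into values modulo l^m. *)
Lemma kh_value_dist m x :
  \prod_(b < l ^ m.+1 | (res (b%:R : Zl) m == res x m)) kh_value m.+1 b%:R ^+ l =
  kh_value m x.
Proof.
under eq_bigr do rewrite exprMn exprVn -(galX l (kh_Kbar m.+1 _)).
have hY b k : Kbar (Y m.+1 b ^+ k) by apply: KbarX; exact: kh_Kbar.
rewrite prodf_div -gal_prod //; congr (sigma _ / _).
  rewrite -(kh_dist hg) [RHS](@reindex_affine _ _ _ _ _ chi^-1 0 _
    (fun y => res y m == res (chi^-1 * x) m) (fun y => Y m.+1 y ^+ l)) ?unitrV ?cyclo_unit //.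
    apply: eq_big => [b|b _]; last by rewrite addr0.
    by rewrite addr0 res_eq_mul // unitrV cyclo_unit.
  move=> y y' yy; split; last by rewrite (one_sub_root_res yy).
  by rewrite (eq_res_le (leqnSn m) yy).
rewrite -(kh_dist hg) [RHS](@reindex_affine _ _ _ _ _ 1 rho _
  (fun y => res y m == res (x + rho) m) (fun y => Y m.+1 y ^+ l)) ?unitr1 //.
  apply: eq_big => [b|b _]; last by rewrite mul1r.
  by rewrite mul1r res_eq_add.
move=> y y' yy; split; last by rewrite (one_sub_root_res yy).
by rewrite (eq_res_le (leqnSn m) yy).
Qed.

(** The right-hand side is the Riemann sum of a^k at level m, in multiplicative form; it remains to
    see that these sums are compatible in m. *)
Lemma polylog_zetapow k m :
  zetapow m (polylog_char hl g sigma k.+1) =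
  \prod_(a < l ^ m) kh_value m a%:R ^+ (a ^ k).
Proof.
pose e m : C := \prod_(a < l ^ m) kh_value m a%:R ^+ (a ^ k).
have eE r : e r = sigma (\prod_(a < l ^ r) Y r (chi^-1 * a%:R) ^+ (a ^ k)) /
    \prod_(a < l ^ r) Y r (a%:R + rho) ^+ (a ^ k).
  rewrite gal_prod => [|a]; last by apply: KbarX; exact: kh_Kbar.
  rewrite -prodf_div; apply: eq_bigr => a _.
  by rewrite galX ?exprMn ?exprVn //; exact: kh_Kbar.
suff [x hx] : exists x : Zl, forall m, e m = zetapow m x.
  have hx' r : zetapow r x = sigma (\prod_(a < l ^ r) Y r (chi^-1 * a%:R) ^+ (a ^ k)) /
    \prod_(a < l ^ r) Y r (a%:R + rho) ^+ (a ^ k) by rewrite -eE hx.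
  rewrite -/(e m) eE.
  exact: (xgetPex (P := [set c : Zl | forall m, zetapow m c =
      sigma (\prod_(a < l ^ m) Y m (chi^-1 * a%:R) ^+ (a ^ k)) /
        \prod_(a < l ^ m) Y m (a%:R + rho) ^+ (a ^ k)]) 0 (ex_intro _ x hx') m).
apply: tate_module => r.
  by rewrite -prodrXl big1 // => a _; rewrite exprAC kh_value_order expr1n.
(* Group b modulo l^(r+1) by its residue a modulo l^r. Exponents count modulo l^(r+1), and there l
   b^k = l a^k since b^k = a^k modulo l^r. *)
rewrite -prodrXl (partition_big (fun b : 'I_(l ^ r.+1) =>
  Ordinal (ltn_pmod b (expl_gt0 hl r))) predT) //=.
apply: eq_bigr => a _; rewrite -(kh_value_dist r a%:R) -prodrXl.
apply: eq_big => [b|b /eqP/(congr1 val)/= ba].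
  by rewrite -val_eqE /= !res_nat [(a %% _)%N]modn_small.
rewrite -!exprM -(expr_mod _ (kh_value_order r.+1 b%:R)).
rewrite -[RHS](expr_mod _ (kh_value_order r.+1 b%:R)); congr (_ ^+ _).
rewrite ![(_ * l)%N]mulnC.
suff : (l * b ^ k = l * a ^ k %[mod l * l ^ r])%N by rewrite -(expnS l r).
by rewrite -!muln_modr -ba modnXm.
Qed.
End KHPath.

(** * Distribution relation for the characters *)

Section Distribution.
Variables (n : nat) (hn : (0 < n)%N) (gp : Omega -> C) (gs : 'I_n -> Omega -> C).
Hypotheses (hp : kh_path gp) (hs : forall s, kh_path (gs s)).
Hypothesis root_dist : forall (s : 'I_n) m,
  gs s (Troot R l m) ^+ n = zetapow m s%:R * gp (Troot R l m).
Hypothesis one_sub_dist : forall m (x : Zl),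
  \prod_(s < n) \prod_(a < l ^ m | (res (n%:R * a%:R + s%:R : Zl) m == res x m))
    gs s (one_sub_root R m (a%:R : Zl)) = gp (one_sub_root R m x).

(** Apply sigma to [root_dist]: the left-hand side picks up n rho_s, and on the right zeta^s turns
    into zeta^(s chi). *)
Lemma kummer_dist s : n%:R * kummer hl (gs s) sigma + s%:R =
  s%:R * chi + kummer hl gp sigma.
Proof.
apply: (@zetapow_inj _ _ R) => m; have hw := kh_Kbar_root hp m.
apply: (mulIf (kh_root_neq0 hp m)).
rewrite zetapowD -mulrA -root_dist [n%:R * _]mulrC zetapowMn -exprMn.
rewrite -kummer_root // -galX; last exact: kh_Kbar_root.
rewrite root_dist galM ?gal_zetapow ?kummer_root //; last exact: Kbar_zetapow.
by rewrite mulrA -zetapowD [chi * _]mulrC.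
Qed.

(** Substitute a |-> a/chi in the numerator and a |-> a + rho_s in the denominator. By [kummer_dist]
    both summation conditions become n a + s chi = x modulo l^m. *)
Lemma kh_value_distribution m x : kh_value gp m x =
  \prod_(s < n) \prod_(a < l ^ m | (res (n%:R * a%:R + s%:R * chi : Zl) m == res x m))
    kh_value (gs s) m a%:R.
Proof.
have chiU := cyclo_unit.
have Yres s (y y' : Zl) : res y m = res y' m ->
    gs s (one_sub_root R m y) = gs s (one_sub_root R m y').
  by move=> yy; rewrite (one_sub_root_res yy).
have Pres (s : 'I_n) (v y y' : Zl) : res y m = res y' m ->
    (res (n%:R * y + s%:R : Zl) m == res (v : Zl) m) =
    (res (n%:R * y' + s%:R : Zl) m == res v m).
  by move=> yy; congr (_ == _); apply: eq_resD => //; exact: eq_resM.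
under [RHS]eq_bigr do rewrite prodf_div -(gal_prod _ _ (fun a => kh_Kbar (hs _) m _)).
rewrite prodf_div -gal_prod => [|s]; last by apply: Kbar_prod => a; exact: (kh_Kbar (hs _)).
rewrite /kh_value -!one_sub_dist; congr (sigma _ / _); apply: eq_bigr => s _.
  rewrite [LHS](@reindex_affine _ _ _ _ _ chi^-1 0 _
    (fun y => res (n%:R * y + s%:R) m == res (chi^-1 * x) m)
    (fun y => gs s (one_sub_root R m y))) ?unitrV //; last first.
    by move=> y y' yy; split; [exact: Pres|exact: Yres].
  apply: eq_big => [a|a _]; last by rewrite addr0.
  rewrite addr0 -(res_eq_mul _ _ _ chiU) mulVKr // mulrDr [chi * s%:R]mulrC.
  by rewrite mulrCA mulVKr.
rewrite [LHS](@reindex_affine _ _ _ _ _ 1 (kummer hl (gs s) sigma) _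
  (fun y => res (n%:R * y + s%:R) m == res (x + kummer hl gp sigma) m)
  (fun y => gs s (one_sub_root R m y))) ?unitr1 //; last first.
  by move=> y y' yy; split; [exact: Pres|exact: Yres].
apply: eq_big => [a|a _]; last by rewrite mul1r.
by rewrite mul1r mulrDr -addrA kummer_dist addrA res_eq_add.
Qed.

Lemma kh_exponent g m : kh_path g -> exists e : Zl -> Zl,
  forall x, kh_value g m x = zetapow m (e x).
Proof.
move=> hg; have /boolp.choice[e he] : forall x, exists e, kh_value g m x = zetapow m e.
  move=> x; have [k ->] := unity_zeta (expl_gt0 hl m) (kh_value_order hg m x).
  by exists k%:R; rewrite zetapow_nat.
by exists e.
Qed.

(** The additive form of [polylog_zetapow]: exponents of zeta_{l^m} replace the roots of unity. *)
Lemma polylog_res g (e : Zl -> Zl) m k : kh_path g ->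
  (forall x, kh_value g m x = zetapow m (e x)) ->
  res (polylog_char hl g sigma k.+1) m = res (\sum_(a < l ^ m) a%:R ^+ k * e a%:R) m.
Proof.
move=> hg he; apply/(zetapow_eq R); rewrite polylog_zetapow // zetapow_sum.
by apply: eq_bigr => a _; rewrite he -zetapowMn natrX mulrC.
Qed.

Lemma polylog_distribution k : polylog_char hl gp sigma k.+1 =
  \sum_(s < n) \sum_(i < k.+1) 'C(k, i)%:R * n%:R ^+ i * (s%:R * chi) ^+ (k - i) *
    polylog_char hl (gs s) sigma i.+1.
Proof.
apply: padicP => m; have [ep hep] := kh_exponent m hp.
have /boolp.choice[es hes] : forall s, exists e : Zl -> Zl,
    forall x, kh_value (gs s) m x = zetapow m (e x) by move=> s; exact: kh_exponent.
rewrite (polylog_res k hp hep).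
have epE x : res (ep x) m = res (\sum_(s < n)
    \sum_(a < l ^ m | (res (n%:R * a%:R + s%:R * chi : Zl) m == res x m)) es s a%:R) m.
  apply/(zetapow_eq R); rewrite -hep kh_value_distribution zetapow_sum.
  by apply: eq_bigr => s _; rewrite zetapow_sum; apply: eq_bigr => a _; rewrite hes.
transitivity (res (\sum_(s < n) \sum_(a < l ^ m)
    (n%:R * a%:R + s%:R * chi) ^+ k * es s a%:R) m).
  transitivity (res (\sum_(x < l ^ m) x%:R ^+ k * \sum_(s < n)
    \sum_(a < l ^ m | (res (n%:R * a%:R + s%:R * chi : Zl) m == res (x%:R : Zl) m))
      es s a%:R) m).
    by apply: eq_res_sum => x _; apply: eq_resM => //; exact: epE.
  under eq_bigr do rewrite mulr_sumr.
  rewrite exchange_big; apply: eq_res_sum => s _.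
  under eq_bigr do rewrite mulr_sumr.
  rewrite (exchange_big_dep predT) //=; apply: eq_res_sum => a _.
  (* A pair (s, a) contributes to a single x, the residue of n a + s chi. *)
  rewrite (big_pred1 (Ordinal (res_lt (n%:R * a%:R + s%:R * chi : Zl) m))) => [|x].
    by apply: eq_resM => //; apply: eq_resX; exact: (res_res _ (leqnn m)).
  by rewrite (res_nat hl x) (modn_small (ltn_ord x)) eq_sym.
apply: eq_res_sum => s _.
under eq_bigr do rewrite addrC exprDn mulr_suml.
rewrite exchange_big; apply: eq_res_sum => i _.
transitivity (res ('C(k, i)%:R * n%:R ^+ i * (s%:R * chi) ^+ (k - i) *
    \sum_(a < l ^ m) a%:R ^+ i * es s a%:R) m); last first.
  by apply: eq_resM => //; apply/esym/polylog_res.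
rewrite mulr_sumr; congr (res _ m); apply: eq_bigr => a _.
rewrite -[in RHS]mulr_natl (exprMn _ n%:R); set X := _ ^+ (k - i); ring.
Qed.
End Distribution.
End Galois.

(** * Measures *)

Section Measures.
Variables (l : nat) (hl : prime l).
Local Notation Zl := (padicint hl).
Local Notation Ql := (padic hl).
Local Notation ofZl := (@ofZl l hl).
Local Notation ball := (@padic_ball l hl).
Implicit Types (c x y : Ql) (U V : set Ql).

Lemma ofZl_inj : injective ofZl.
Proof. by move=> u v /eqP; rewrite /Defs.ofZl tofrac_eq => /eqP. Qed.

Lemma ofZl_natr k : ofZl k%:R = k%:R.
Proof. by rewrite /Defs.ofZl rmorph_nat. Qed.

Lemma natr_padic_neq0 k : (0 < k)%N -> k%:R != 0 :> Ql.
Proof.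
move=> k0; rewrite -ofZl_natr /Defs.ofZl tofrac_eq0.
exact: padic_natr_neq0.
Qed.

Lemma ballP x y m : ball x m y <-> exists u : Zl, y = x + ofZl ((l ^ m)%:R * u).
Proof.
have E u : l%:R ^+ m * ofZl u = ofZl ((l ^ m)%:R * u) by rewrite rmorphM /= ofZl_natr natrX.
by split=> [[u _ <-]|[u ->]]; exists u; rewrite // E.
Qed.

Lemma ball_trans x y m : ball x m y -> ball y m = ball x m.
Proof.
move=> /ballP[u ->]; apply/seteqP; split=> z /ballP[v ->]; apply/ballP.
  by exists (u + v); rewrite mulrDr rmorphD addrA.
by exists (v - u); rewrite mulrBr rmorphB /= -addrA [ofZl _ + _]addrC subrK.
Qed.

Lemma ball_res c (u v : Zl) m : ball (c + ofZl u) m (c + ofZl v) <-> res u m = res v m.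
Proof.
rewrite ballP; split=> [[w]|uv].
  rewrite -addrA -rmorphD => /addrI/ofZl_inj ->.
  rewrite -[in LHS](addr0 u); apply: eq_resD => //.
  by rewrite res0; apply/esym/res_eq0P; exists w.
have /res_sub_eq0/res_eq0P[w wE] : res v m = res u m by [].
by exists w; rewrite -wE rmorphB /= addrACA subrr addr0.
Qed.

Lemma cosetP c x : coset c x <-> exists u : Zl, x = c + ofZl u.
Proof.
by rewrite /coset ballP; split=> -[u ->]; exists u; rewrite mul1r.
Qed.

Definition level m U := forall x, U x -> ball x m `<=` U.

Lemma levelS m k U : (m <= k)%N -> level m U -> level k U.
Proof. by move=> mk hU x /hU; apply: subset_trans; exact: padic_ballS. Qed.

Lemma level_ball x m : level m (ball x m).
Proof. by move=> y /ball_trans ->. Qed.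

Lemma level_open m U : level m U -> open U.
Proof.
move=> hU; rewrite openE => x /hU xU.
by exists m.
Qed.

(* An ultrafilter on c + Z_l picks one residue class at each level. *)
Lemma coset_compact c : compact (coset c).
Proof.
rewrite compact_ultra => F FU Fc.
have pick m : exists k, F (ball (c + k%:R) m).
  apply: contrapT => /forallNP nF.
  have nFk k : F (~` ball (c + k%:R) m).
    by have [/nF//|] := in_ultra_setVsetC (ball (c + k%:R) m) FU.
  have : \forall x \near F, forall k : 'I_(l ^ m), ~ ball (c + k%:R) m x.
    by apply: filter_forall => k; exact: nFk.
  move=> /(filterI Fc) /filter_ex[x [/cosetP[u ->] hx]].
  apply: (hx (Ordinal (res_lt u m))).
  by rewrite -ofZl_natr; apply/ball_res; rewrite res_res.
have [k hk] := boolp.choice pick.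
have k_compat m : k m = k m.+1 %[mod l ^ m].
  have [x [h1 h2]] := filter_ex (filterI (hk m) (hk m.+1)).
  move: (padic_ballS (leqnSn m) h2) => /ball_trans xE.
  move: h1 => /ball_trans; rewrite xE => /seteqP[/(_ _ (padic_ball_refl _ _)) + _].
  by rewrite -!ofZl_natr ball_res !res_nat.
exists (c + ofZl (mkpadic hl k_compat)); split; first by apply/cosetP; eexists.
move=> A [m hA]; apply: filterS (hk m); apply: subset_trans hA.
rewrite -ofZl_natr -(ball_trans (y := c + ofZl (k m)%:R)) //.
by apply/ball_res; rewrite res_nat.
Qed.

(** The complement of a set of level m is again of level m, hence open, so [U] is closed in a
    compact coset. *)
Lemma level_compact c m U : U `<=` coset c -> level m U -> compact U.
Proof.
move=> Uc hU; rewrite (_ : U = coset c `&` U); last first.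
  by apply/seteqP; split=> x => [Ux|[]//]; split=> //; exact: Uc.
apply: compact_closedI; first exact: coset_compact.
rewrite -openC; apply: (@level_open m) => x nUx y yx Uy; apply: nUx.
by apply: (hU _ Uy); rewrite (ball_trans yx); exact: padic_ball_refl.
Qed.

Lemma level_compact_open c m U : U `<=` coset c -> level m U ->
  compact_open_in (coset c) U.
Proof.
by move=> Uc hU; split=> //; [exact: (level_compact Uc hU)|exact: (level_open hU)].
Qed.

(** Compactness, in its near-covering form, replaces the radii at the points of [U] by a uniform
    one. *)
Lemma compact_open_level X U : compact_open_in X U -> exists m, level m U.
Proof.
move=> [_ /compact_near_coveringP Uco Uop].
suff : \forall m \near \oo, forall x, U x -> ball x m `<=` U.
  by move=> [m _ /(_ m)] h; exists m => x; apply: h => /=.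
apply: Uco => x Ux.
have [m hm] : nbhs x U by rewrite nbhsE; exists U.
exists (ball x m, [set k | m <= k]%N).
  by split; [exists m|exists m].
move=> [y k] [/= yx mk]; apply: subset_trans hm.
by rewrite -(ball_trans yx); exact: padic_ballS.
Qed.
End Measures.

(** * Binomial coefficients as indicators of divisibility by l^M *)

Section Binomial.
Variables (l : nat) (hl : prime l).

(* X C(X-1,q-1) = q C(X,q) for q = l^M, and v(X - i) = v(i) for 0 < i < q when q | X. *)
Lemma dvdn_bin_pred M X : (0 < X)%N ->
  (l %| 'C(X.-1, (l ^ M).-1))%N = ~~ (l ^ M %| X)%N.
Proof.
move=> X0; have q0 : (0 < l ^ M)%N by rewrite expn_gt0 prime_gt0.
have [qX|qX] := boolP (l ^ M %| X)%N; last first.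
  have := mul_bin_diag X (l ^ M).-1; rewrite prednK // => binE.
  have [/eqP|B0] := posnP 'C(X.-1, (l ^ M).-1); first by move/eqP->; rewrite dvdn0.
  have : (l ^ M %| X * 'C(X.-1, (l ^ M).-1))%N by rewrite binE dvdn_mulr.
  rewrite pfactor_dvdn ?muln_gt0 ?X0 // lognM // => MX.
  rewrite -[l in (l %| _)%N]expn1 pfactor_dvdn //.
  by move: qX; rewrite pfactor_dvdn // -ltnNge; lia.
suff ffE k : (k < l ^ M)%N -> logn l (X.-1 ^_ k) = logn l k`! /\ (0 < X.-1 ^_ k)%N.
  have qq : ((l ^ M).-1 < l ^ M)%N by rewrite prednK.
  have [vE ff0] := ffE _ qq.
  have B0 : (0 < 'C(X.-1, (l ^ M).-1))%N.
    by rewrite bin_gt0 -ltnS !prednK // dvdn_leq.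
  move: vE; rewrite -bin_ffact lognM ?fact_gt0 // => vE.
  rewrite -[l in (l %| _)%N]expn1 pfactor_dvdn //=; lia.
elim: k => [|k IH] kq; first by rewrite ffactn0 fact0.
have [vE ff0] := IH (ltnW kq).
have qleX := dvdn_leq X0 qX.
have Xk : (0 < X.-1 - k)%N by lia.
rewrite ffactnSr factS muln_gt0 ff0 Xk !lognM ?fact_gt0 // vE addnC; split=> //.
congr (_ + _)%N.
have XE : (X = (X.-1 - k) + k.+1)%N by lia.
have dvdE r : (r <= M)%N -> (l ^ r %| X.-1 - k)%N = (l ^ r %| k.+1)%N.
  move=> rM; have rX : (l ^ r %| X)%N by exact: dvdn_trans (dvdn_exp2l _ rM) qX.
  by apply/idP/idP => h; move: rX; rewrite [X in (_ %| X)%N]XE;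
    [rewrite dvdn_addr|rewrite dvdn_addl].
have vkM : (logn l k.+1 < M)%N.
  rewrite ltnNge; apply/negP; rewrite -pfactor_dvdn // => /(dvdn_leq (ltn0Sn k)).
  lia.
apply/eqP; rewrite eqn_leq; apply/andP; split; last first.
  by rewrite -pfactor_dvdn // dvdE ?(ltnW vkM) // pfactor_dvdn.
rewrite leqNgt; apply/negP; rewrite -pfactor_dvdn // dvdE //.
by rewrite pfactor_dvdn // ltnn.
Qed.

(** The factor phi(l^N) sends units to 1 by Euler's theorem; the factor N makes the exponent at
    least N, which kills multiples of l. *)
Lemma modn_bin_pred_exp M N X : (0 < X)%N -> (0 < N)%N ->
  'C(X.-1, (l ^ M).-1) ^ (N * totient (l ^ N)) = (l ^ M %| X)%N %[mod l ^ N].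
Proof.
move=> X0 N0; have := dvdn_bin_pred M X0; case: (l ^ M %| X)%N => /= lB.
  rewrite mulnC expnM -modnXm Euler_exp_totient ?modnXm ?exp1n //.
  by rewrite coprime_pexpr // coprime_sym prime_coprime // lB.
rewrite mod0n; apply/eqP; rewrite -/(dvdn _ _).
apply: dvdn_trans (dvdn_exp2r _ lB); apply: dvdn_exp2l.
by rewrite leq_pmulr // totient_gt0 expn_gt0 prime_gt0.
Qed.
End Binomial.

(** * Measures and their moments *)

Section MeasureTheory.
Variables (l : nat) (hl : prime l).
Local Notation Zl := (padicint hl).
Local Notation Ql := (padic hl).
Local Notation ofZl := (@ofZl l hl).
Local Notation ball := (@padic_ball l hl).
Implicit Types (c : Ql) (U V : set Ql) (kappa : set Ql -> Zl).

Lemma ball_nat c i j m : ball (c + i%:R) m (c + j%:R) <-> i = j %[mod l ^ m].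
Proof. by rewrite -!ofZl_natr ball_res !res_nat. Qed.

Lemma ball_sub_coset c i m : ball (c + i%:R) m `<=` coset c.
Proof.
move=> x /(padic_ballS (leq0n m)); rewrite /coset (@ball_trans _ _ c) //.
by apply/cosetP; exists i%:R; rewrite ofZl_natr.
Qed.

Lemma coset_ball c x m : coset c x -> exists2 j, (j < l ^ m)%N & ball (c + j%:R) m x.
Proof.
move=> /cosetP[u ->]; exists (res u m); first exact: res_lt.
by rewrite -ofZl_natr; apply/ball_res; rewrite res_res.
Qed.

Lemma measure0 c kappa : is_measure (coset c) kappa -> kappa set0 = 0.
Proof.
move=> hk; have h0 : compact_open_in (coset c) (set0 : set Ql).
  exact: (@level_compact_open _ _ _ 0%N).
have := hk _ _ h0 h0 (set0I _); rewrite setU0 -{1}[kappa set0]addr0 => /addrI.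
by [].
Qed.

Lemma measure_level c kappa m U : is_measure (coset c) kappa ->
  U `<=` coset c -> level m U ->
  kappa U = \sum_(j < l ^ m | `[< U (c + j%:R) >]) kappa (ball (c + j%:R) m).
Proof.
move=> hk Uc hU.
(* Additivity is given for two disjoint sets, so the balls making up [U] are adjoined one at a
   time. *)
pose W k := [set x | exists j, [/\ (j < k)%N, U (c + j%:R) & ball (c + j%:R) m x]].
have Wlevel k : level m (W k).
  by move=> x [j [jk Uj xj]] y; rewrite (ball_trans xj) => yj; exists j.
have Wc k : W k `<=` coset c by move=> x [j [_ _ /ball_sub_coset]].
have WE k : (k <= l ^ m)%N ->
    kappa (W k) = \sum_(j < k | `[< U (c + j%:R) >]) kappa (ball (c + j%:R) m).
  elim: k => [|k IH] kq.
    rewrite big_ord0 (_ : W 0%N = set0) ?(measure0 hk) //.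
    by apply/seteqP; split=> // x [j []].
  rewrite big_mkcond big_ord_recr -big_mkcond /= -IH ?(ltnW kq) //.
  case: ifPn => [/asboolP Uk|/asboolPn nUk].
    have -> : W k.+1 = W k `|` ball (c + k%:R) m.
      apply/seteqP; split=> x.
        move=> [j [+ Uj xj]]; rewrite ltnS leq_eqVlt => /orP[/eqP jk|jk].
          by right; rewrite -jk.
        by left; exists j.
      by move=> [[j [jk Uj xj]]|xk]; [exists j; split=> //; exact: ltnW|exists k].
    apply: hk; first exact: (level_compact_open (Wc k) (Wlevel k)).
      by apply: (@level_compact_open _ _ _ m); [exact: ball_sub_coset|exact: level_ball].
    apply/seteqP; split=> // x [[j [jk _ /ball_trans xj]] /ball_trans xk].
    have := padic_ball_refl (c + k%:R) m; rewrite -xk xj ball_nat.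
    by rewrite !modn_small //; lia.
  rewrite addr0; congr kappa; apply/seteqP; split=> x [j [jk Uj xj]]; exists j; split=> //.
    by move: jk; rewrite ltnS leq_eqVlt => /orP[/eqP jk|//]; rewrite jk in Uj.
  exact: ltnW.
rewrite -WE //; congr kappa; apply/seteqP; split=> x.
  move=> Ux; have [j jq xj] := coset_ball m (Uc _ Ux).
  by exists j; split=> //; apply: (hU _ Ux); rewrite (ball_trans xj); exact: padic_ball_refl.
by move=> [j [_ Uj xj]]; exact: (hU _ Uj).
Qed.

Lemma measure_refine c kappa m k i : is_measure (coset c) kappa -> (m <= k)%N ->
  kappa (ball (c + i%:R) m) =
  \sum_(j < l ^ k | (j == i %[mod l ^ m])%N) kappa (ball (c + j%:R) k).
Proof.
move=> hk mk; rewrite (measure_level hk (@ball_sub_coset c i m)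
  (levelS mk (@level_ball _ _ _ _))).
apply: eq_bigl => j; apply/asboolP/eqP => [/ball_nat//|ji]; exact/ball_nat.
Qed.

(** The functions that are 1-Lipschitz for the l-adic metric. *)
Definition nat_compat (g : nat -> Zl) :=
  forall i j m, i = j %[mod l ^ m] -> res (g i) m = res (g j) m.

(** For such integrands, refining beyond level M changes nothing modulo l^M: an integral can be read
    modulo l^M from one finite sum. *)
Lemma riemann_sum_res c kappa (g : nat -> Zl) M m : is_measure (coset c) kappa ->
  nat_compat g -> (M <= m)%N ->
  res (\sum_(j < l ^ m) g j * kappa (ball (c + j%:R) m)) M =
  res (\sum_(j < l ^ M) g j * kappa (ball (c + j%:R) M)) M.
Proof.
move=> hk hg Mm.
under [in RHS]eq_bigr => i _.
  rewrite (measure_refine _ hk Mm) mulr_sumr.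
  over.
rewrite /= (exchange_big_dep predT) //=; apply: eq_res_sum => j _.
rewrite (big_pred1 (Ordinal (ltn_pmod j (expl_gt0 hl M)))) => [|i] /=.
  by apply: eq_resM => //; apply: hg; rewrite modn_mod.
by rewrite -val_eqE /= [(i %% _)%N]modn_small // eq_sym.
Qed.

(* The function x |-> C(x + l^M - a - 1, l^M - 1)^e with e = N phi(l^N) is a polynomial
   with rational coefficients and is congruent mod l^N to the indicator of a + l^M Z. *)
Lemma measure_moments_eq0 kappa : is_measure (coset 0) kappa ->
  (forall k m, res (\sum_(j < l ^ m) j%:R ^+ k * kappa (ball (0 + j%:R) m)) m = 0%N) ->
  forall U, compact_open_in (coset 0) U -> kappa U = 0.
Proof.
move=> hk mom U hU; have [M lU] := compact_open_level hU; case: hU => Uc _ _.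
rewrite (measure_level hk Uc lU) big1 // => -[a /= aM] _.
apply: padicP => N; rewrite res0.
have [->|N0] := posnP N; first by apply/eqP; rewrite -leqn0 -ltnS -[1%N](expn0 l) res_lt.
set q := (l ^ M)%N in aM *; set e := (N * totient (l ^ N))%N.
(* j + t is the predecessor of j + q - a, which q divides exactly when j = a modulo q. *)
pose t := (q - a).-1.
pose f x := ('C(x + t, q.-1) ^ e)%N.
pose D := (q.-1`! ^ e)%N.
pose G : {poly Zl} := (\prod_(i < q.-1) ('X + (t%:R - i%:R)%:P)) ^+ e.
have fD x : G.[x%:R] = (D * f x)%:R.
  rewrite horner_exp horner_prod /D /f -expnMn mulnC bin_ffact natrX; congr (_ ^+ _).
  elim: q.-1 => [|k IH]; first by rewrite big_ord0 ffactn0.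
  rewrite big_ord_recr /= IH ffactnSr natrM !hornerE.
  have [kxt|kxt] := leqP k (x + t); last by rewrite ffact_small ?mul0r.
  by rewrite natrB // natrD.
(* [D] clears the denominators of [f]. Dividing by it again costs [w] digits, so the moments are
   used modulo l^(N + w), and [M] is added to reach a level finer than that of [U]. *)
set w := logn l D; set m := (N + w + M)%N.
have D0 : (0 < D)%N by rewrite expn_gt0 fact_gt0.
set S := \sum_(j < l ^ m) (f j)%:R * kappa (ball (0 + j%:R) m).
have DS : res (D%:R * S) m = 0%N.
  have -> : D%:R * S = \sum_(k < size G) G`_k *
      \sum_(j < l ^ m) j%:R ^+ k * kappa (ball (0 + j%:R) m).
    under [RHS]eq_bigr do rewrite mulr_sumr.
    rewrite exchange_big /S mulr_sumr; apply: eq_bigr => j _.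
    rewrite mulrA -natrM -fD horner_coef mulr_suml.
    by apply: eq_bigr => k _; rewrite mulrA.
  by apply: res_sum_eq0 => k _; rewrite resM mom muln0 mod0n.
have S0 : res S N = 0%N.
  have : (l ^ m %| D * res S m)%N.
    by move: DS; rewrite resM res_nat modnMml /dvdn => ->.
  have Nm : (N <= m)%N by rewrite /m -addnA leq_addr.
  rewrite -(res_le S Nm).
  have [->|Sm] := posnP (res S m); first by rewrite mod0n.
  rewrite pfactor_dvdn ?muln_gt0 ?D0 // lognM // -/w => mle.
  by apply/eqP; rewrite -/(dvdn _ _) pfactor_dvdn //; move: mle; rewrite /m; lia.
rewrite -S0 (measure_refine a hk (leq_addl (N + w) M)) big_mkcond /=.
apply: eq_res_sum => j _.
have indE : res ((f j)%:R : Zl) N = res (((j == a %[mod q])%N)%:R : Zl) N.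
  rewrite !res_nat /f.
  have -> : (j + t = (j + q - a).-1)%N by rewrite /t; lia.
  rewrite modn_bin_pred_exp //; last by lia.
  by rewrite -/q -eqn_mod_dvd ?modnDr //; lia.
rewrite (eq_resM indE (erefl (res (kappa (ball (0 + j%:R) m)) N))).
by case: eqP => _; rewrite ?mul1r ?mul0r.
Qed.

Lemma is_measureB X kappa lambda : is_measure X kappa -> is_measure X lambda ->
  is_measure X (fun U => kappa U - lambda U : Zl).
Proof. by move=> hk hl' U V hU hV UV; rewrite hk // hl' // opprD addrACA. Qed.

Lemma is_measure_sum (I : Type) (s : seq I) X (F : I -> set Ql -> Zl) :
  (forall i, is_measure X (F i)) -> is_measure X (fun U => \sum_(i <- s) F i U).
Proof.
move=> hF U V hU hV UV; rewrite -big_split; apply: eq_bigr => i _; exact: hF.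
Qed.

Definition preimage_mul n c U := [set a | coset c a /\ U (n%:R * a)].

Lemma level_preimage_mul n c m U : level m U -> level m (preimage_mul n c U).
Proof.
move=> hU x [cx Ux] y xy; split.
  by move: (padic_ballS (leq0n m) xy); rewrite /coset (ball_trans cx).
apply: (hU _ Ux); move: xy => /ballP[u ->]; apply/ballP; exists (n%:R * u).
by rewrite mulrDr mulrCA [in RHS]rmorphM /= ofZl_natr.
Qed.

Lemma is_measure_pushforward n c kappa : is_measure (coset c) kappa ->
  is_measure (coset 0) (pushforward n c kappa).
Proof.
move=> hk U V hU hV UV.
have co W : compact_open_in (coset 0) W -> compact_open_in (coset c) (preimage_mul n c W).
  move=> /compact_open_level[m /(@level_preimage_mul n c) hW].
  by apply: level_compact_open hW => x [].
rewrite -[LHS]/(kappa (preimage_mul n c (U `|` V))).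
rewrite (_ : preimage_mul n c (U `|` V) = preimage_mul n c U `|` preimage_mul n c V).
  apply: hk; [exact: co|exact: co|].
  apply/seteqP; split=> // x [[_ Ux] [_ Vx]].
  by have : (U `&` V) (n%:R * x) by []; rewrite UV.
apply/seteqP; split=> x; first by move=> [cx [|]]; [left|right].
by move=> [|] [cx h]; split=> //; [left|right].
Qed.

Lemma has_integral_ball c kappa (f : Ql -> Ql) I : has_integral c kappa f I ->
  forall M, exists m0, forall m, (m0 <= m)%N ->
    ball I M (\sum_(j < l ^ m) f (c + j%:R) * ofZl (kappa (ball (c + j%:R) m))).
Proof.
move=> hI M; have : nbhs I (ball I M) by exists M.
by move=> /hI [m0 _ hm0]; exists m0 => m m0m; exact: hm0.
Qed.

Lemma nat_compatX (s n k : nat) : nat_compat (fun j => (s + n * j)%:R ^+ k : Zl).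
Proof.
move=> i j m ij; apply: eq_resX; rewrite !res_nat.
by rewrite -modnDmr -modnMmr ij modnMmr modnDmr.
Qed.

(* With c = s/n, the hypothesis is about the moments of [kappa], the conclusion about
   those of [n]_* kappa. *)
Lemma moment_res (s n k : nat) kappa (I J : _) M : (0 < n)%N ->
  is_measure (coset (s%:R / n%:R)) kappa ->
  has_integral (s%:R / n%:R) kappa (fun a => a ^+ k) I -> n%:R ^+ k * I = ofZl J ->
  res (\sum_(j < l ^ M) (s + n * j)%:R ^+ k * kappa (ball (s%:R / n%:R + j%:R) M)) M =
  res J M.
Proof.
move=> n0 hk hI IJ; have [m0 hm0] := has_integral_ball hI M.
have := hm0 _ (leq_maxl m0 M); set m := maxn m0 M => /ballP[u].
move=> /(congr1 ( *%R (n%:R ^+ k))); rewrite mulrDr IJ mulr_sumr.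
have -> : n%:R ^+ k * ofZl ((l ^ M)%:R * u) = ofZl ((l ^ M)%:R * (n%:R ^+ k * u)).
  by rewrite [in RHS]mulrCA [in RHS]rmorphM rmorphXn /= ofZl_natr.
rewrite -rmorphD /=; have n0' := natr_padic_neq0 hl n0.
have -> : \sum_(j < l ^ m) n%:R ^+ k * ((s%:R / n%:R + j%:R) ^+ k *
      ofZl (kappa (ball (s%:R / n%:R + j%:R) m))) =
    ofZl (\sum_(j < l ^ m) (s + n * j)%:R ^+ k * kappa (ball (s%:R / n%:R + j%:R) m)).
  rewrite rmorph_sum; apply: eq_bigr => j _.
  rewrite rmorphM rmorphXn /= ofZl_natr natrD natrM mulrA -exprMn.
  by rewrite mulrDr [n%:R * (s%:R / _)]mulrC divfK.
move=> /ofZl_inj sumE.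
rewrite -(riemann_sum_res hk (@nat_compatX s n k) (leq_maxr m0 M)) -/m sumE.
rewrite -[in RHS](addr0 J); apply: eq_resD => //.
by rewrite res0; apply/res_eq0P; exists (n%:R ^+ k * u).
Qed.

(** As n (s/n + j) = s + n j, the ball of s/n + j lies over the single ball of s + n j. *)
Lemma moment_pushforward (s n k : nat) kappa m : (0 < n)%N ->
  is_measure (coset (s%:R / n%:R)) kappa ->
  res (\sum_(i < l ^ m) i%:R ^+ k *
         pushforward n (s%:R / n%:R) kappa (ball (0 + i%:R) m)) m =
  res (\sum_(j < l ^ m) (s + n * j)%:R ^+ k * kappa (ball (s%:R / n%:R + j%:R) m)) m.
Proof.
move=> n0 hk; have n0' := natr_padic_neq0 hl n0; set c := s%:R / n%:R.
under eq_bigr => i _.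
  rewrite -[pushforward _ _ _ _]/(kappa (preimage_mul n c (ball (0 + i%:R) m))).
  rewrite (measure_level (m := m) hk); last first.
  - by apply: level_preimage_mul; exact: level_ball.
  - by move=> x [].
  rewrite mulr_sumr (eq_bigl (fun j : 'I_(l ^ m) => (s + n * j == i %[mod l ^ m])%N)).
    over.
  move=> j; have ncj : n%:R * (c + j%:R) = 0 + (s + n * j)%:R.
    by rewrite add0r natrD natrM mulrDr [n%:R * c]mulrC divfK.
  apply/asboolP/eqP; first by move=> [_]; rewrite ncj => /ball_nat.
  move=> ji; split; first by apply/cosetP; exists j%:R; rewrite ofZl_natr.
  by rewrite ncj; apply/ball_nat.
rewrite /= (exchange_big_dep predT) //=; apply: eq_res_sum => j _.
rewrite (big_pred1 (Ordinal (ltn_pmod (s + n * j) (expl_gt0 hl m)))) => [|i] /=.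
  by apply: eq_resM => //; apply: eq_resX; rewrite !res_nat modn_mod.
by rewrite -val_eqE /= [(i %% _)%N]modn_small // eq_sym.
Qed.

Lemma measure_distribution n kappa (kappas : 'I_n -> set Ql -> Zl)
    (A : nat -> Zl) (B : 'I_n -> nat -> Zl) (I : 'I_n -> nat -> Ql) : (0 < n)%N ->
  is_measure (coset 0) kappa ->
  (forall k, has_integral 0 kappa (fun a => a ^+ k) (ofZl (A k))) ->
  (forall s : 'I_n, is_measure (coset (s%:R / n%:R)) (kappas s)) ->
  (forall (s : 'I_n) k, has_integral (s%:R / n%:R) (kappas s) (fun a => a ^+ k) (I s k)) ->
  (forall s k, n%:R ^+ k * I s k = ofZl (B s k)) ->
  (forall k, A k = \sum_(s < n) B s k) ->
  forall U, compact_open_in (coset 0) U ->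
  kappa U = \sum_(s < n) pushforward n (s%:R / n%:R) (kappas s) U.
Proof.
move=> n0 hk intA hks intB IB AB U hU; apply/eqP; rewrite -subr_eq0; apply/eqP.
have hpush (s : 'I_n) := is_measure_pushforward n (hks s).
apply: (measure_moments_eq0 (is_measureB hk (is_measure_sum _ hpush))) hU => k m.
under eq_bigr do rewrite mulrBr mulr_sumr.
rewrite sumrB exchange_big; apply/res_sub_eq0.
(* Z_l itself is treated as the coset with s = 0 and n = 1, so that [moment_res] also gives the
   moments of [kappa]. *)
have div01 : (0%:R / 1%:R : Ql) = 0 by rewrite mul0r.
have hk1 := hk; have intA1 := intA k; rewrite -div01 in hk1 intA1.
have -> : \sum_(i < l ^ m) i%:R ^+ k * kappa (ball (0 + i%:R) m) =
    \sum_(i < l ^ m) (0 + 1 * i)%N%:R ^+ k * kappa (ball (0%:R / 1%:R + i%:R) m).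
  by apply: eq_bigr => i _; rewrite add0n mul1n div01.
rewrite (moment_res (J := A k) m (ltn0Sn 0) hk1 intA1) ?expr1n ?mul1r //.
rewrite AB; apply: eq_res_sum => s _.
by rewrite moment_pushforward // (moment_res m n0 (hks s) (intB s k) (IB s k)).
Qed.
End MeasureTheory.

(** * Paths on V_1 *)

Section PathsOnV1.
Variables (R : realType) (K : divringClosed R[i]) (l : nat) (hl : prime l).
Variables (n : nat) (hn : (0 < n)%N) (z : R[i]) (gamma : puiseux R[i] -> R[i]).
Hypotheses (hz : Vpoint K n z) (hgamma : is_path K l n z gamma).
Local Notation C := R[i].
Local Notation Omega := (puiseux C).
Local Notation Zl := (padicint hl).
Local Notation zetapow := (@zetapow R l hl).
Local Notation w m := (gamma (Troot R l m)).

(** A common form of the two kinds of paths: (d, k) = (n, 1) with c = 1 for pi_n(gamma), and (1, n)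
    with c_m = e^(2 pi i s/(n l^m)) for the rotated ones. *)
Lemma kh_pathP (g : Omega -> C) (d k : nat) (c : nat -> C) : (d * k = n)%N ->
  (forall m, c m.+1 ^+ l = c m) -> c 0%N ^+ k = 1 ->
  (forall m, g (Troot R l m) = c m * w m ^+ d) ->
  (forall m (x : Zl),
    g (one_sub_root R m x) = gamma (one_sub_pow l d m m (c m * zetapow m x))) ->
  g (Troot R l 0) \in K -> kh_path hl K g.
Proof.
move=> dk cS c0k gT gY gK; have [zK z0 zn] := hz.
have [d0 k0] : (0 < d)%N /\ (0 < k)%N.
  by move: hn; rewrite -dk muln_gt0 => /andP.
have l0 := prime_gt0 hl.
have w0 : w 0 = z by rewrite -(path_Troot hl hgamma 0) expr1.
have ck m : c m ^+ (k * l ^ m) = 1.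
  elim: m => [|m IH]; first by rewrite muln1.
  by rewrite expnS mulnCA exprM cS.
have czk m (x : Zl) : (c m * zetapow m x) ^+ (k * l ^ m) = 1.
  by rewrite exprMn ck mul1r mulnC exprM zetapow_order expr1n.
split.
- by move=> m; rewrite !gT exprMn cS exprAC (path_TrootS hl hgamma).
- split=> //; rewrite gT w0.
    rewrite mulf_neq0 ?expf_neq0 //; apply/eqP => c0; move: c0k.
    by rewrite c0 expr0n gtn_eqF //= => /eqP; rewrite eq_sym oner_eq0.
  apply: contraNneq zn => /(congr1 (fun t => t ^+ k)).
  by rewrite exprMn c0k mul1r -exprM dk expr1n => ->.
- move=> m x; rewrite gY (path_one_sub_pow hl hn hgamma _ dk (czk m x)) gT.
  by rewrite mulrA [zetapow m x * _]mulrC.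
(* The classes b over x are x0 + j l^m with j < l, and the product over j of 1 - zeta_l^j y
   T^(d/l^(m+1)) is 1 - y^l T^(d/l^m). *)
move=> m x; pose G b := gamma (one_sub_pow l d m.+1 m (c m.+1 * zeta R (l ^ m.+1) ^+ b)).
transitivity (\prod_(b < l ^ m * l | (b %% l ^ m == res x m)%N) G b).
  rewrite -(expnSr l m); apply: eq_big => [b|b _]; first by rewrite res_nat.
  have cov := cover_elt_one_sub_pow K hl hn m.+1 dk (czk m.+1 b%:R).
  by rewrite gY -(pathX hl hgamma l cov) one_sub_powS // zetapow_nat.
rewrite big_ord_residue ?res_lt // gY.
have cb b : (c m.+1 * zeta R (l ^ m.+1) ^+ b) ^+ (k * l ^ m.+1) = 1.
  by rewrite -(zetapow_nat hl); exact: czk.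
have cov b := cover_elt_one_sub_pow K hl hn m dk (cb b).
rewrite /G -(path_prod hl hgamma _ (fun j : 'I_l => cov (res x m + j * l ^ m)%N)).
congr gamma; set x0 := res x m.
have zE (j : nat) : c m.+1 * zeta R (l ^ m.+1) ^+ (x0 + j * l ^ m) =
    zeta R l ^+ j * (c m.+1 * zeta R (l ^ m.+1) ^+ x0).
  rewrite exprD -[zeta R l ^+ j](zetaXM R l j (expl_gt0 hl m)) -(expnS l m).
  by rewrite mulrA mulrC.
under eq_bigr do rewrite zE.
rewrite (prod_one_sub_pow hl) // /one_sub_pow; congr binser.
  have lQ : l%:R != 0 :> rat by rewrite pnatr_eq0 -lt0n.
  by rewrite (expnS l m) natrM invfM mulrCA mulVKf.
by rewrite exprMn cS exprAC zetaS.
Qed.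

Lemma path_pow_Troot m : path_pow hn gamma (Troot R l m) = w m ^+ n.
Proof.
rewrite -(pathX hl hgamma n (cover_elt_Troot K l n m)) TpowX.
by rewrite /path_pow powmap_Tpow.
Qed.

Lemma path_rot_Troot s m :
  path_rot n s gamma (Troot R l m) = expi R (s%:R / n%:R / (l ^ m)%:R) * w m.
Proof.
rewrite /path_rot rotmap_Tpow (path_scale hl hgamma _ _ (cover_elt_Troot K l n m)) //.
  apply: (Kbar_unity K (n := n * l ^ m)); first by rewrite muln_gt0 hn expl_gt0.
  have n0 : n%:R != 0 :> rat by rewrite pnatr_eq0 -lt0n.
  have q0 : (l ^ m)%:R != 0 :> rat by rewrite pnatr_eq0 -lt0n expl_gt0.
  by rewrite -expiMn natrM [n%:R * _]mulrC [X in expi R X]mulrC mulrA !divfK // expi_nat.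
exact: expi_neq0.
Qed.

Lemma kh_path_pow : kh_path hl K (path_pow hn gamma).
Proof.
have [zK z0 zn] := hz.
apply: (@kh_pathP _ n 1 (fun=> 1)); rewrite ?muln1 ?expr1n //.
- by move=> m /=; rewrite mul1r path_pow_Troot.
- by move=> m x /=; rewrite mul1r /path_pow powmap_binser.
have := path_Troot hl hgamma 0; rewrite expr1 path_pow_Troot => ->.
exact: rpredX.
Qed.

Lemma kh_path_rot s : (forall x : C, x ^+ n = 1 -> x \in K) ->
  kh_path hl K (path_rot n s gamma).
Proof.
move=> muK; have [zK z0 zn] := hz; have n0 : n%:R != 0 :> rat by rewrite pnatr_eq0 -lt0n.
have c0n : expi R (s%:R / n%:R / (l ^ 0)%:R) ^+ n = 1.
  by rewrite divr1 -expiMn mulrCA mulfV // mulr1 expi_nat.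
apply: (@kh_pathP _ 1 n (fun m => expi R (s%:R / n%:R / (l ^ m)%:R))) => //.
- by rewrite mul1n.
- move=> m; rewrite -expiMn (expnS l m) natrM invfM; congr (expi R _).
  by rewrite mulrCA mulVKf // pnatr_eq0 -lt0n prime_gt0.
- by move=> m; rewrite expr1 path_rot_Troot.
- move=> m x; rewrite /path_rot rotmap_binser ?invr_gt0 ?ltr0n ?expl_gt0 // mulrN.
  by rewrite /one_sub_pow div1r.
rewrite path_rot_Troot; apply: rpredM; first exact: muK.
by have := path_Troot hl hgamma 0; rewrite expr1 => ->.
Qed.

Lemma path_root_dist (s : 'I_n) m : path_rot n s gamma (Troot R l m) ^+ n =
  zetapow m s%:R * path_pow hn gamma (Troot R l m).
Proof.
have n0 : n%:R != 0 :> rat by rewrite pnatr_eq0 -lt0n.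
rewrite path_rot_Troot path_pow_Troot exprMn zetapow_nat zetaX -expiMn.
by congr (expi R _ * _); rewrite mulrA [_ / n%:R]mulrC mulrA mulfV // mul1r.
Qed.

(* The factorization 1 - c^n T^n = prod_j (1 - zeta_n^j c T), regrouped along
   j = n a + s. *)
Lemma path_one_sub_dist m (x : Zl) :
  \prod_(s < n) \prod_(a < l ^ m | (res (n%:R * a%:R + s%:R : Zl) m == res x m))
    path_rot n s gamma (one_sub_root R m (a%:R : Zl)) =
  path_pow hn gamma (one_sub_root R m x).
Proof.
have q0 : (0 < l ^ m)%N by exact: expl_gt0.
have n0 : n%:R != 0 :> rat by rewrite pnatr_eq0 -lt0n.
have q0' : (l ^ m)%:R != 0 :> rat by rewrite pnatr_eq0 -lt0n.
set u := zeta R (n * l ^ m).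
pose G j := gamma (one_sub_pow l 1 m m (u ^+ j)).
transitivity (\prod_(j < n * l ^ m | (j %% l ^ m == res x m)%N) G j).
  rewrite (big_ord_mul _ n (l ^ m) (fun j => j %% l ^ m == res x m)%N).
  rewrite (exchange_big_dep predT) //=; apply: eq_bigr => a _.
  apply: eq_big => [s|s _]; first by rewrite !res_nat modnMml modnMmr modnDm.
  (* The rotation contributes e^(2 pi i s/(n l^m)), and its product with zeta_{l^m}^a is u^(n a +
     s). *)
  rewrite /path_rot rotmap_binser ?invr_gt0 ?ltr0n // mulrN zetapow_nat zetaX -expiD.
  rewrite /G /one_sub_pow div1r /u zetaX; congr (gamma (binser _ _ (- expi R _))).
  by rewrite natrD !natrM; field; rewrite n0 q0'.
rewrite mulnC big_ord_residue ?res_lt //.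
have uk b : (u ^+ b) ^+ (n * l ^ m) = 1.
  by rewrite exprAC (prim_expr_order (zeta_prim _ _)) ?expr1n // muln_gt0 hn.
have cov b := cover_elt_one_sub_pow K hl hn m (mul1n n) (uk b).
rewrite /G -(path_prod hl hgamma _ (fun j : 'I_n => cov (res x m + j * l ^ m)%N)).
rewrite /path_pow powmap_binser; congr gamma.
have zE (j : nat) : u ^+ (res x m + j * l ^ m) = zeta R n ^+ j * u ^+ res x m.
  by rewrite exprD zetaXM // mulrC.
under eq_bigr do rewrite zE.
rewrite (prod_one_sub_pow hl) // div1r; congr (binser _ _ (- _)).
by rewrite -exprM /u [(n * l ^ m)%N]mulnC zetaXM.
Qed.
End PathsOnV1.

Theorem theorem7p2 (R : realType) (l : nat) (hl : prime l)
    (K : divringClosed R[i]) (n : nat) (hn : (0 < n)%N)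
    (muK : forall x : R[i], x ^+ n = 1 -> x \in K)
    (z : R[i]) (hz : Vpoint K n z)
    (gamma : puiseux R[i] -> R[i]) (hgamma : is_path K l n z gamma)
    (sigma : R[i] -> R[i]) (hsigma : in_Gal K sigma)
    (kappa : set (padic hl) -> padicint hl)
    (hkappa : is_KH_measure (path_pow hn gamma) sigma kappa)
    (kappas : 'I_n -> set (padic hl) -> padicint hl)
    (hkappas : forall s : 'I_n,
       is_KH_measureQ (qpath_rot hl n s gamma) sigma (kappas s))
    (U : set (padic hl)) (hU : compact_open_in (coset 0) U) :
  kappa U = \sum_(s < n) pushforward n (s%:R / n%:R) (kappas s) U.
Proof.
have hs s := kh_path_rot hl hn hz hgamma s muK.
have hp := kh_path_pow hl hn hz hgamma.
pose chi := cyclo hl sigma.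
pose polylog (s : 'I_n) i := polylog_char hl (path_rot n s gamma) sigma i.
apply: (@measure_distribution _ hl n kappa kappas
  (fun k => polylog_char hl (path_pow hn gamma) sigma k.+1)
  (fun s k => \sum_(i < k.+1) 'C(k, i)%:R * n%:R ^+ i * (s%:R * chi) ^+ (k - i) *
     polylog s i.+1)
  (fun s k => \sum_(i < k.+1) 'C(k, i)%:R * (s%:R / n%:R * ofZl chi) ^+ (k - i) *
     ofZl (polylog s i.+1))) => //.
- by case: hkappa.
- by move=> k; case: hkappa => _ /(_ k.+1 isT).
- by move=> s; case: (hkappas s).
- by move=> s k; case: (hkappas s) => _ /(_ k.+1 isT).
(* Of the factor n^k, the part n^(k-i) cancels the denominator of (s/n chi)^(k-i), and n^i remains
   as the coefficient in the relation for the characters. *)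
- move=> s k; have n0 := natr_padic_neq0 hl hn.
  rewrite rmorph_sum mulr_sumr; apply: eq_bigr => i _.
  rewrite !rmorphM !rmorphXn rmorphM !rmorph_nat /=.
  have nk : n%:R ^+ k = n%:R ^+ i * n%:R ^+ (k - i) :> padic hl.
    by rewrite -exprD subnKC // -ltnS.
  have -> : s%:R * ofZl chi = n%:R * (s%:R / n%:R * ofZl chi).
    by rewrite mulrA [n%:R * _]mulrC divfK.
  by rewrite nk [in RHS]exprMn; set t := (_ / _ * _) ^+ _; ring.
- move=> k; apply: (polylog_distribution hsigma hp (fun s : 'I_n => hs s)
    (path_root_dist hl hn hgamma) (path_one_sub_dist hn hgamma)).
Qed.
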